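(* Let $p\in[1,\infty)$ and $\varepsilon\in(0,1)$. Let $\Phi$ be a $\mathbf{\Phi}$-function such that $t\mapsto \Phi(t)t^{-p}$ is increasing on $(0,\infty)$, and assume that there is $q\in[p,\infty)$ such that $t\mapsto\Phi(t)t^{-q}$ is decreasing on $(0,\infty)$. Then there is a constant $C_{\Phi,\varepsilon}>0$, depending only on $\Phi$ and $\varepsilon$, such that for every compact $\Omega\subset\mathbb{R}^d$, every Borel probability measure $\mu$ on $\Omega$, every $N\ge 1$, every $B>0$ and every $N$-dimensional subspace $X_N\subset C(\Omega)$ satisfying $$\|f\|_\infty\le \sqrt{BN}\,\|f\|_{2}\quad\forall f\in X_N,$$ there exist $$m\le C_{\Phi,\varepsilon}\,\Phi\bigl((BN)^{\frac{1}{\min\{p,2\}}}\bigr)(\log 2BN)^3$$ and points $\mathbf{x}=\{x_1,\dots,x_m\}\subset\Omega$ (not necessarily distinct) such that $$(1-\varepsilon)\|f\|_\Phi\le\|f\|_{\Phi,\mathbf{x}}\le(1+\varepsilon)\|f\|_\Phi\quad\forall f\in X_N.$$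
   Context: $\log$ is the logarithm to base 2. ''Increasing'' and ''decreasing'' are meant in the non-strict sense. A $\mathbf{\Phi}$-function is an increasing function $\Phi:[0,\infty)\to[0,\infty)$ with $\Phi(0)=0$, $\lim_{t\to0+}\Phi(t)=0$, $\lim_{t\to\infty}\Phi(t)=\infty$, such that $t\mapsto\Phi(t)t^{-1}$ is almost increasing on $(0,\infty)$, i.e. there is $a\ge1$ with $\Phi(s)s^{-1}\le a\,\Phi(t)t^{-1}$ for all $0<s<t$. $C(\Omega)$ is the space of continuous (real- or complex-valued) functions on $\Omega$; $\|f\|_\infty=\max_{x\in\Omega}|f(x)|$; $\|f\|_2=(\int_\Omega|f|^2\,d\mu)^{1/2}$. For a probability measure $\nu$, $\|f\|_{L^\Phi(\nu)}:=\inf\{\lambda>0:\int\Phi(|f|/\lambda)\,d\nu\le1\}$. We write $\|f\|_\Phi:=\|f\|_{L^\Phi(\mu)}$ and $\|f\|_{\Phi,\mathbf{x}}:=\|f\|_{L^\Phi(\nu)}$ with $\nu=\frac1m\sum_{j=1}^m\delta_{x_j}$. *)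

(* Defs.v *)
From mathcomp Require Export all_boot all_order all_algebra.
From mathcomp Require Export all_classical all_reals all_analysis.
From mathcomp Require Export complex.

Set Implicit Arguments.
Unset Strict Implicit.
Unset Printing Implicit Defensive.

Import Order.TTheory GRing.Theory Num.Theory.
Import numFieldNormedType.Exports numFieldTopology.Exports.

Local Open Scope classical_set_scope.
Local Open Scope ring_scope.

Definition log2 {R : realType} (x : R) : R := ln x / ln 2.

Section phi_function.
Context {R : realType}.

(* Functions on [0, +oo[ are total functions on R whose values at negative
   arguments are irrelevant. *)
Record Phi_function (Phi : R -> R) : Prop := {
  Phi_ge0 : forall t : R, 0 <= t -> 0 <= Phi t ;
  Phi_incr : forall s t : R, 0 <= s -> s <= t -> Phi s <= Phi t ;
  Phi0 : Phi 0 = 0 ;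
  Phi_cvg0 : Phi t @[t --> 0^'+] --> 0 ;
  Phi_cvgy : Phi t @[t --> +oo] --> +oo ;
  Phi_almost_incr : exists2 a : R, 1 <= a &
    forall s t : R, 0 < s -> s < t -> Phi s / s <= a * (Phi t / t) }.

Definition pos_increasing (g : R -> R) :=
  forall s t : R, 0 < s -> s <= t -> g s <= g t.

Definition pos_decreasing (g : R -> R) :=
  forall s t : R, 0 < s -> s <= t -> g t <= g s.

End phi_function.

(* Functions are real- or complex-valued; the modulus lands in R because the
   norm of the numFieldType R[i] takes its values in R[i]. *)
Inductive scalar_field (R : realType) :
    forall K : numFieldType, (K -> R) -> Prop :=
  | real_scalars : @scalar_field R R (fun z => `|z|)
  | complex_scalars : @scalar_field R R[i] (@ComplexField.Normc.normc R).

Notation borel_rV R d := (g_sigma_algebraType (@open 'rV[R]_d)).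

(* An element of C(Omega) is represented by a function on the whole space that
   is continuous on Omega; its values outside Omega play no role: X is a set of
   such functions saturated for equality on Omega, and linear independence is
   that of the restrictions to Omega. *)
Definition subspace_of_dim (T : topologicalType) (K : numFieldType)
    (Omega : set T) (N : nat) (X : set (T -> K)) :=
  exists u : 'I_N -> T -> K,
    [/\ forall i, {within Omega, continuous (u i)},
        forall c : 'I_N -> K,
          (forall x, Omega x -> \sum_(i < N) c i * u i x = 0) ->
          forall i, c i = 0
      & X = [set f | exists c : 'I_N -> K,
               forall x, Omega x -> f x = \sum_(i < N) c i * u i x]].

(* In the three norms below, g stands for the modulus |f| of a function f. *)
Definition sup_norm {T : Type} {R : realType} (Omega : set T) (g : T -> R) :
    \bar R :=
  ereal_sup [set (g x)%:E | x in Omega].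

Section norms.
Context {d : measure_display} {T : measurableType d} {R : realType}.
Local Open Scope ereal_scope.

Definition L2_norm (nu : {measure set T -> \bar R}) (Omega : set T)
    (g : T -> R) : \bar R :=
  (\int[nu]_(x in Omega) (g x ^+ 2)%:E) `^ 2^-1.

Definition luxemburg_norm (Phi : R -> R) (nu : {measure set T -> \bar R})
    (Omega : set T) (g : T -> R) : \bar R :=
  ereal_inf [set l%:E | l in [set l : R | (0 < l)%R /\
    \int[nu]_(x in Omega) (Phi (g x / l))%:E <= 1]].

(* (1/m) (delta_(x_1) + ... + delta_(x_m)) *)
Definition empirical_measure (m : nat) (x : m.-tuple T) :
    {measure set T -> \bar R} :=
  mscale ((m%:R^-1)%:nng)%R (msum (fun j => \d_(nth point x j)) m).

End norms.

(* Main.v *)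
Require Import Defs.
From mathcomp Require Import all_boot all_order all_algebra.
From mathcomp Require Import all_classical all_reals all_analysis.
From mathcomp Require Import complex.
From mathcomp Require Import finmap measurable_realfun.
From mathcomp Require Import ring lra.

Import Order.TTheory GRing.Theory Num.Theory.
Import numFieldNormedType.Exports numFieldTopology.Exports.

Local Open Scope classical_set_scope.
Local Open Scope ring_scope.

Set Implicit Arguments.
Unset Strict Implicit.
Unset Printing Implicit Defensive.

(** Put M = B N and r = min(p, 2).  Separating real and imaginary parts, X_N
    becomes a real-linear family c |-> f_c of plane-valued functions, and the
    two norms are compared through the modular, the integral of Phi(|f_c|).
    If the empirical modular is within eps/2 of the true one on the ball where
    the latter is at most 1, then the Luxemburg norms agree up to 1 +- eps,
    because Phi(t)/t increases and Phi(t)/t^q decreases ([gauge_upper],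
    [gauge_lower]).  On that ball |f| <= A with A^r of order M: the square of
    the L2 norm is at most sup|f|^(2-r) times the integral of |f|^r, which Phi
    controls, and the hypothesis turns this into a bound for sup|f|
    ([modular_sup]).  Apart from eps, all constants
    depend only on Phi(1) and q.

    Points.  A partition of Omega into small cells replaces mu by a uniform
    measure on 2^L points, L huge and out of control, with an arbitrarily small
    error ([quantize]).  The points are then paired and one point of each pair
    is kept, again and again, until 2^l points remain.  Keeping one point per
    pair according to signs e_i changes the sum of Phi(|f|) by half a signed sum
    of the differences of Phi(|f|) over the pairs, so that one step is good as
    soon as the supremum over f of a Rademacher process is small.  The relative
    error of the step from n = 2^j points is of order sqrt(Phi(A) j^3 / 2^j)
    ([halving]).  These errors decay geometrically as j grows, so the last step
    dominates and Phi(A) l^3 << eps^2 2^l suffices ([core_sampling]).  Since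
    Phi(A) is at most a power of M up to a constant, l is of order log(2M), and
    the cube of the logarithm appears ([choose_level]).

    One halving step.  The supremum is bounded by chaining over nets N_k at the
    uniform scales t_k with t_k^r = A^r / 2^k.  The q-growth of Phi gives
    (Phi(t) - Phi(s))^2 <= 4 q^2 |t-s|^r (Phi(s) + Phi(t)) Phi(A)/A^r
    ([Phi_holder]), hence the variance of a link at level k is at most a
    constant times n Phi(A) / 2^k.  On the other side log |N_k| is at most a
    constant times 2^k log n ([nets]); so all levels contribute equally, and
    about log n levels are needed.

    Entropy.  If f and g lie in the modular ball and |f - g| <= t at the points,
    then the mean square of f - g is at most a constant times t^(2-r).  It
    remains to cover a Euclidean ball uniformly on n points at scale s, where
    the sup norm is at most sqrt(Q) times the Euclidean norm.  A greedy walk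
    does it: as long as some component of the residual exceeds s, a step along
    the vector representing that component lowers the squared norm by s^2/Q.
    The centre reached is described by the at most (radius)^2 Q / s^2 steps,
    each chosen among O(n) directions ([perceptron_cover]).  This plays the
    part of the dual Sudakov inequality.

    The cover needs the bound of the sup norm by the L2 norm for the current
    empirical measure, not for mu.  Therefore the halving preserves the L2 norm
    together with the modular: the same lemma is applied to t^2, and a sign
    vector good for both exists since each is bad with probability below 1/2. *)

(** * Plane-valued linear families and greedy coverings *)

Section hypot.
Context {R : realType}.
Implicit Types a b : R.

Definition hypot a b : R := Num.sqrt (a ^+ 2 + b ^+ 2).

Lemma hypot_ge0 a b : 0 <= hypot a b.
Proof. exact: sqrtr_ge0. Qed.

Lemma sqr_hypot a b : hypot a b ^+ 2 = a ^+ 2 + b ^+ 2.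
Proof. by rewrite sqr_sqrtr // addr_ge0 // sqr_ge0. Qed.

Lemma hypotN a b : hypot (- a) (- b) = hypot a b.
Proof. by rewrite /hypot !sqrrN. Qed.

Lemma hypotD a b a' b' : hypot (a + a') (b + b') <= hypot a b + hypot a' b'.
Proof.
rewrite -ler_sqr ?nnegrE ?addr_ge0 ?hypot_ge0// sqrrD !sqr_hypot.
have h : a * a' + b * b' <= hypot a b * hypot a' b'.
  apply: le_trans (ler_norm _) _.
  rewrite -ler_sqr ?nnegrE ?mulr_ge0 ?hypot_ge0//.
  rewrite real_normK ?num_real// exprMn !sqr_hypot.
  have := sqr_ge0 (a * b' - a' * b); lra.
move: h; rewrite -mulr_natr; lra.
Qed.

Lemma hypot_dist a b a' b' : `|hypot a b - hypot a' b'| <= hypot (a - a') (b - b').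
Proof.
have h1 := hypotD (a - a') (b - b') a' b'; rewrite !subrK in h1.
have h2 := hypotD (a' - a) (b' - b) a b.
rewrite !subrK -(opprB a) -(opprB b) hypotN in h2.
by rewrite ler_norml; apply/andP; split; lra.
Qed.

Lemma hypot_le a b t : `|a| <= t -> `|b| <= t -> hypot a b <= t *+ 2.
Proof.
move=> ha hb; have t0 : 0 <= t := le_trans (normr_ge0 _) ha.
rewrite -ler_sqr ?nnegrE ?hypot_ge0 ?mulrn_wge0// sqr_hypot.
have k z : `|z| <= t -> z ^+ 2 <= t ^+ 2.
  by move=> hz; rewrite -[X in X <= _]real_normK ?num_real// ler_sqr ?nnegrE.
have := k _ ha; have := k _ hb; have := sqr_ge0 t.
by rewrite -mulr_natr exprMn; lra.
Qed.

End hypot.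

Section modulus.
Context {R : realType} {N : nat} {T : Type}.
Variable U : T -> bool -> 'cV[R]_N.
Implicit Types (c : 'rV[R]_N) (x : T).

(** The linear map c |-> f_c is stored through its values: the component s of
    f_c at x is c *m U x s.  Real-valued functions have second component 0. *)
Definition cval c x s : R := (c *m U x s) 0 0.

Definition modl c x : R := hypot (cval c x false) (cval c x true).

Lemma cval0 x s : cval 0 x s = 0.
Proof. by rewrite /cval mul0mx mxE. Qed.

Lemma cvalD c1 c2 x s : cval (c1 + c2) x s = cval c1 x s + cval c2 x s.
Proof. by rewrite /cval mulmxDl mxE. Qed.

Lemma cvalN c x s : cval (- c) x s = - cval c x s.
Proof. by rewrite /cval mulNmx mxE. Qed.

Lemma cvalB c1 c2 x s : cval (c1 - c2) x s = cval c1 x s - cval c2 x s.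
Proof. by rewrite cvalD cvalN. Qed.

Lemma cvalZ a c x s : cval (a *: c) x s = a * cval c x s.
Proof. by rewrite /cval -scalemxAl mxE. Qed.

Lemma modl_ge0 c x : 0 <= modl c x.
Proof. exact: sqrtr_ge0. Qed.

Lemma sqr_modl c x : modl c x ^+ 2 = cval c x false ^+ 2 + cval c x true ^+ 2.
Proof. exact: sqr_hypot. Qed.

Lemma modl0 x : modl 0 x = 0.
Proof. by rewrite /modl /hypot !cval0 expr0n /= addr0 sqrtr0. Qed.

Lemma modlZ a c x : modl (a *: c) x = `|a| * modl c x.
Proof.
by rewrite /modl /hypot !cvalZ !exprMn -mulrDr sqrtrM ?sqr_ge0// sqrtr_sqr.
Qed.

Lemma modlN c x : modl (- c) x = modl c x.
Proof. by rewrite -scaleN1r modlZ normrN1 mul1r. Qed.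

Lemma modlD c1 c2 x : modl (c1 + c2) x <= modl c1 x + modl c2 x.
Proof. by rewrite /modl !cvalD hypotD. Qed.

Lemma modl_dist c1 c2 x : `|modl c1 x - modl c2 x| <= modl (c1 - c2) x.
Proof. by rewrite /modl !cvalB hypot_dist. Qed.

Lemma cval_le_modl c x s : `|cval c x s| <= modl c x.
Proof.
rewrite -ler_sqr ?nnegrE ?modl_ge0// real_normK ?num_real// sqr_modl.
by case: s; rewrite ?lerDl ?lerDr sqr_ge0.
Qed.

Lemma modl_le_cval c x t :
  (forall s, `|cval c x s| <= t) -> modl c x <= t *+ 2.
Proof. by move=> h; apply: hypot_le. Qed.

Lemma modl_dist_points c x y t :
  (forall s, `|cval c y s - cval c x s| <= t) -> `|modl c y - modl c x| <= t *+ 2.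
Proof. by move=> h; apply: le_trans (hypot_dist _ _ _ _) _; apply: hypot_le. Qed.

End modulus.

Section cover.
Context {R : realType} {N : nat} {P : finType}.
Variable U : P -> bool -> 'cV[R]_N.
Implicit Types (c : 'rV[R]_N) (p : P).

Definition energy c : R := \sum_p modl U c p ^+ 2.

Definition dotp c1 c2 : R :=
  \sum_p \sum_s cval U c1 p s * cval U c2 p s.

Lemma energyE c : energy c = dotp c c.
Proof.
apply: eq_bigr => p _; rewrite sqr_modl big_bool /= addrC.
by rewrite !expr2.
Qed.

Lemma energy_ge0 c : 0 <= energy c.
Proof. by apply: sumr_ge0 => p _; rewrite sqr_ge0. Qed.

(** The Gram matrix may be singular, but a vector of its kernel has zero energy,
    so every component vanishes on it; hence the functional lies in the row space. *)
Lemma riesz_cval p0 s0 : exists k, forall c, dotp k c = cval U c p0 s0.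
Proof.
pose G : 'M[R]_N := \sum_p \sum_s U p s *m (U p s)^T.
have GE (a b : 'rV[R]_N) : (a *m G *m b^T) 0 0 = dotp a b.
  rewrite mulmx_sumr mulmx_suml summxE; apply: eq_bigr => p _.
  rewrite mulmx_sumr mulmx_suml summxE; apply: eq_bigr => s _.
  rewrite !mulmxA -mulmxA -trmx_mul mxE big_ord1.
  by rewrite /cval [X in _ * X]mxE.
have sub : ((U p0 s0)^T <= G)%MS.
  rewrite submxE; apply/eqP/matrixP => i j; rewrite [RHS]mxE (ord1 i).
  pose dd := (col j (cokermx G))^T.
  have Gd : G *m dd^T = 0.
    by rewrite /dd trmxK colE mulmxA mulmx_coker mul0mx.
  have : dotp dd dd = 0 by rewrite -GE -mulmxA Gd mulmx0 mxE.
  rewrite -energyE => /eqP; rewrite psumr_eq0; last by move=> *; rewrite sqr_ge0.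
  move=> /allP /(_ p0 (mem_index_enum _)) /=; rewrite sqrf_eq0 => /eqP h.
  have := cval_le_modl U dd p0 s0; rewrite h normr_le0 => /eqP.
  rewrite /cval /dd => h'; rewrite -[RHS]h'.
  rewrite !mxE; apply: eq_bigr => k _; by rewrite !mxE mulrC.
have [k kE] := submxP sub; exists k => c.
rewrite -GE -kE -trmx_mul /cval [LHS]mxE.
by [].
Qed.

(** The energy of the residual drops by s0^2 / Q with each step of length s0 / Q
    along the representer of a component that exceeds s0, and there are 4 #|P|
    signed representers.  A step may also be void, so that shorter walks count
    as walks of length L. *)
Lemma perceptron_cover (Q s0 : R) (L : nat) : 0 < Q -> 0 < s0 ->
  (forall c p, modl U c p ^+ 2 <= Q * energy c) ->
  exists S : seq 'rV[R]_N,
    [/\ size S = ((4 * #|P|).+1 ^ L)%N, 0 \in S &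
    forall c, energy c <= L%:R * (s0 ^+ 2 / Q) ->
      exists2 b, b \in S & forall p s, `|cval U (c - b) p s| <= s0].
Proof.
move=> Q0 s00 hQ.
pose k p s := projT1 (cid (riesz_cval p s)).
have kP p s c : dotp (k p s) c = cval U c p s.
  by rewrite /k; case: cid.
have kQ p s : energy (k p s) <= Q.
  have e1 : energy (k p s) = cval U (k p s) p s by rewrite energyE kP.
  have h : energy (k p s) ^+ 2 <= Q * energy (k p s).
    apply: le_trans (hQ (k p s) p).
    rewrite {1}e1 -real_normK ?num_real// ler_sqr ?nnegrE ?modl_ge0//.
    exact: cval_le_modl.
  have := energy_ge0 (k p s); rewrite le_eqVlt => /orP[/eqP <-|]; first exact: ltW.
  by move=> h0; move: h; rewrite expr2 ler_pM2r.
pose eta := s0 / Q.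
pose dirs := [seq (if u.1 then eta else - eta) *: k u.2.1 u.2.2
             | u <- enum {: bool * (P * bool)}].
have sdirs : size dirs = (4 * #|P|)%N.
  by rewrite size_map -cardE !card_prod card_bool mulnCA mulnC.
elim: L => [|L [S [sS S0 hS]]].
  exists [:: 0]; split; rewrite ?inE// => c; rewrite mul0r => ec.
  exists 0; first by rewrite inE.
  move=> p s; rewrite subr0; apply: le_trans (cval_le_modl _ _ _ _) _.
  apply: (@le_trans _ _ 0); last exact: ltW.
  rewrite -(@ler_sqr _ _ 0) ?nnegrE ?modl_ge0// expr0n/=.
  by apply: le_trans (hQ c p) _; rewrite mulr_ge0_le0 // ltW.
exists [seq b + d | b <- S, d <- 0 :: dirs]; split.
- by rewrite size_allpairs sS /= sdirs expnSr.
- by apply/allpairsP; exists (0, 0); rewrite /= addr0 inE eqxx; split.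
move=> c ec.
have [small|] := pselect (forall p s, `|cval U c p s| <= s0).
  exists 0; last by move=> p s; rewrite subr0.
  by apply/allpairsP; exists (0, 0); rewrite /= addr0 inE eqxx; split.
move=> /existsNP[p /existsNP[s /negP]]; rewrite -ltNge => big.
pose d := (if 0 <= cval U c p s then eta else - eta) *: k p s.
have eta0 : 0 < eta by rewrite divr_gt0.
have dd : d \in dirs.
  apply/mapP; exists (0 <= cval U c p s, (p, s)) => //.
  by rewrite mem_enum.
have drop : energy (c - d) <= L%:R * (s0 ^+ 2 / Q).
  have -> : energy (c - d) = energy c - 2 * (eta * `|cval U c p s|)
                             + eta ^+ 2 * energy (k p s).
    rewrite -(kP p s c) !energyE /d.
    set sg := if _ then _ else _.
    have -> : eta * `|dotp (k p s) c| = sg * dotp (k p s) c.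
      rewrite /sg kP; case: ifPn => [/ger0_norm ->//|].
      by rewrite -ltNge => /ltr0_norm ->; rewrite mulrN mulNr.
    have -> : eta ^+ 2 = sg ^+ 2 by rewrite /sg; case: ifP; rewrite ?sqrrN.
    rewrite /dotp !mulr_sumr -!sumrN -!big_split/=; apply: eq_bigr => i _.
    rewrite !mulr_sumr -!sumrN -!big_split/=; apply: eq_bigr => j _.
    rewrite !cvalB !cvalZ; ring.
  have h1 : eta ^+ 2 * energy (k p s) <= s0 ^+ 2 / Q.
    apply: le_trans (_ : eta ^+ 2 * Q <= _).
      by rewrite ler_wpM2l ?sqr_ge0.
    by have -> : eta ^+ 2 * Q = s0 ^+ 2 / Q by rewrite /eta; field; rewrite gt_eqF.
  have h2 : s0 ^+ 2 / Q <= eta * `|cval U c p s|.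
    have -> : s0 ^+ 2 / Q = eta * s0 by rewrite /eta; field; rewrite gt_eqF.
    by rewrite ler_pM2l// ltW.
  by move: ec; rewrite -natr1 mulrDl mul1r; lra.
have [b bS hb] := hS _ drop.
exists (b + d).
  by apply/allpairsP; exists (b, d); rewrite /= inE dd orbT.
by move=> p' s'; rewrite opprD addrA addrAC.
Qed.

End cover.

(** * Nets of the modular ball *)

(** Centres of a covering can be replaced by points of the covered set, at the
    price of a factor 2 in the radius. *)
Lemma pick_net (V I : eqType) (D : I -> set V) (s : seq I) :
  exists w : seq V,
    [/\ (size w <= size s)%N,
        forall g, g \in w -> exists2 i, i \in s & D i g &
        forall i f, i \in s -> D i f -> exists2 g, g \in w & D i g].
Proof.
elim: s => [|i s [w [sw w1 w2]]]; first by exists [::]; split.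
have [[f Df]|no] := pselect (exists f, D i f).
  exists (f :: w); split => //.
    move=> g; rewrite inE => /orP[/eqP ->|/w1[j js Dj]].
      by exists i; rewrite ?inE ?eqxx.
    by exists j; rewrite // inE js orbT.
  move=> j g; rewrite inE => /orP[/eqP -> _|js Dj].
    by exists f; rewrite ?inE ?eqxx.
  by have [h hw Dh] := w2 _ _ js Dj; exists h; rewrite // inE hw orbT.
exists w; split; first exact: ltnW.
  by move=> g /w1[j js Dj]; exists j; rewrite // inE js orbT.
move=> j g; rewrite inE => /orP[/eqP -> Dg|js Dj]; last exact: w2 Dj.
by exfalso; apply: no; exists g.
Qed.

Section powers.
Context {R : realType}.
Implicit Types r t x y : R.

Lemma powR_split r t : 0 < t -> t `^ (2 - r) * t `^ r = t ^+ 2.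
Proof.
move=> t0; rewrite -powRD ?subrK ?powR_mulrn ?(ltW t0)//.
by rewrite (gt_eqF t0) implybT.
Qed.

Lemma powRD_le4 r x y : 0 <= r <= 2 -> 0 <= x -> 0 <= y ->
  (x + y) `^ r <= 4 * (x `^ r + y `^ r).
Proof.
move=> /andP[r0 r2]; wlog xy : x y / x <= y => [hw|] x0 y0.
  have [xy|yx] := leP x y; first exact: hw.
  by rewrite addrC [X in _ <= 4 * X]addrC; apply: hw => //; apply: ltW.
apply: le_trans (_ : (2 * y) `^ r <= _).
  by apply: ge0_ler_powR => //; rewrite ?nnegrE; lra.
rewrite powRM//.
have h : (2 : R) `^ r <= 4.
  have -> : 4 = (2 : R) `^ 2 by rewrite powR_mulrn//; lra.
  by rewrite ler_powR//; lra.
have h1 := powR_ge0 x r; have h2 := powR_ge0 y r.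
apply: le_trans (_ : 4 * y `^ r <= _); first by rewrite ler_wpM2r.
by rewrite ler_wpM2l //; lra.
Qed.

End powers.

Section nets.
Context {R : realType} {N : nat} {P : finType}.
Variable U : P -> bool -> 'cV[R]_N.
Variables (Phi : R -> R) (A kappa r : R).
Implicit Types (c f g : 'rV[R]_N) (p : P).

Notation n := (#|P|).
Notation modl := (modl U).

(** The value 2 leaves room for the errors made by the halvings: elements of
    modular at most 1 for mu stay in this set for all the empirical measures. *)
Definition small_set c :=
  (forall p, modl c p <= A) /\ \sum_p Phi (modl c p) <= 2 * n%:R.

Hypothesis A0 : 0 < A.
Hypothesis r12 : 1 <= r <= 2.
Hypothesis n0 : (0 < n)%N.
Hypothesis Phi0 : Phi 0 = 0.
Hypothesis hQ : forall c p, modl c p ^+ 2 <= A `^ r / n%:R * energy U c.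
Hypothesis hk : forall t : R, 0 <= t -> t `^ r <= kappa * (1 + Phi t).

(** The scales of the chaining: scale^r is divided by 2 at each level. *)
Definition scale k : R := A * 2 `^ (- (k%:R / r)).

Lemma scale_gt0 k : 0 < scale k.
Proof. by rewrite mulr_gt0// powR_gt0. Qed.

Lemma scale0 : scale 0 = A.
Proof. by rewrite /scale mul0r oppr0 powRr0 mulr1. Qed.

Lemma scale_pow k : scale k `^ r = A `^ r / 2 ^+ k.
Proof.
rewrite /scale powRM ?powR_ge0 ?(ltW A0)// -powRrM mulNr divfK.
  by rewrite powRN powR_mulrn.
by rewrite gt_eqF//; case/andP: r12; lra.
Qed.

Lemma scale_half k : scale k / 2 <= scale k.+1.
Proof.
rewrite /scale -mulrA ler_pM2l// -[k.+1%:R]natr1 mulrDl opprD powRD; last first.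
  by rewrite (gt_eqF (_ : 0 < 2))// implybT.
rewrite ler_pM2l ?powR_gt0// powRN lef_pV2 ?posrE ?powR_gt0//.
have r1 : 1 <= r by case/andP: r12.
rewrite -[leRHS]powRr1// ler_powR// ?div1r ?invf_le1//; lra.
Qed.

Lemma small_set0 : small_set 0.
Proof.
split=> [p|]; first by rewrite modl0 ltW.
by rewrite big1 ?mulr_ge0// => p _; rewrite modl0.
Qed.

(** Interpolation: |f - g|^2 <= t^(2-r) |f - g|^r, and |f|^r, |g|^r are summable
    because Phi grows at least like the power r. *)
Lemma energy_close f g (t : R) : 0 < t -> small_set f -> small_set g ->
  (forall p, modl (f - g) p <= t) ->
  energy U (f - g) <= t `^ (2 - r) * (24 * kappa * n%:R).
Proof.
move=> t0 [_ f2] [_ g2] fg; have [r1 r2] := andP r12.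
apply: le_trans (_ : \sum_p t `^ (2 - r) * (4 * (kappa * (1 + Phi (modl f p))
   + kappa * (1 + Phi (modl g p)))) <= _).
  apply: ler_sum => p _.
  apply: le_trans (_ : t `^ (2 - r) * modl (f - g) p `^ r <= _).
    have [->|m0] := eqVneq (modl (f - g) p) 0.
      by rewrite expr0n/= mulr_ge0 ?powR_ge0.
    have m1 : 0 < modl (f - g) p by rewrite lt_neqAle eq_sym m0 modl_ge0.
    rewrite -(powR_split r)// ler_wpM2r ?powR_ge0//.
    by apply: ge0_ler_powR; rewrite ?nnegrE ?modl_ge0 ?(ltW t0) ?subr_ge0.
  rewrite ler_wpM2l ?powR_ge0//.
  apply: le_trans (_ : (modl f p + modl g p) `^ r <= _).
    apply: ge0_ler_powR; rewrite ?nnegrE ?addr_ge0 ?modl_ge0//; first by lra.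
    by apply: le_trans (modlD U f (- g) p) _; rewrite modlN.
  apply: le_trans (powRD_le4 _ _ _) _; rewrite ?modl_ge0//; first by lra.
  have h1 := hk (modl_ge0 U f p); have h2 := hk (modl_ge0 U g p); lra.
rewrite -mulr_sumr ler_wpM2l ?powR_ge0//.
have -> : \sum_p 4 * (kappa * (1 + Phi (modl f p)) + kappa * (1 + Phi (modl g p)))
    = 4 * (kappa * (n%:R + \sum_p Phi (modl f p)) + kappa * (n%:R + \sum_p Phi (modl g p))).
  have -> : n%:R = \sum_(p : P) (1 : R) by rewrite sumr_const.
  rewrite -!big_split/= !mulr_sumr -big_split/= mulr_sumr.
  by [].
have k0 : 0 <= kappa.
  have := hk (lexx 0); rewrite Phi0 addr0 mulr1; apply: le_trans; exact: powR_ge0.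
have -> : 24 * kappa * n%:R = 4 * (kappa * (n%:R + 2 * n%:R) + kappa * (n%:R + 2 * n%:R)) by ring.
rewrite ler_wpM2l// lerD// ler_wpM2l// lerD2l//.
Qed.

(* 1536 = 64 * 24: 24 comes from energy_close and 64 from the radius scale k / 8. *)
Variable L0 : nat.
Hypothesis hL0 : 1536 * kappa <= L0%:R.

(** A cell of radius scale k around g is refined by covering the differences f - g,
    which form a Euclidean ball whose radius shrinks with k by energy_close.  The
    code length L0 2^k of the refinement doubles with k, so the last one
    dominates the total. *)
Lemma nets k : exists w : seq 'rV[R]_N,
  [/\ (size w <= (4 * n).+1 ^ (L0 * 2 ^ k))%N,
      forall g, g \in w -> small_set g &
      forall f, small_set f -> exists2 g, g \in w & forall p, modl (f - g) p <= scale k].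
Proof.
elim: k => [|k [w [sw w1 w2]]].
  exists [:: 0]; split.
  - by rewrite /= expn_gt0.
  - by move=> g; rewrite inE => /eqP ->; exact: small_set0.
  - move=> f [fA _]; exists 0; rewrite ?inE// => p.
    by rewrite subr0 scale0.
have Q0 : 0 < A `^ r / n%:R by rewrite divr_gt0 ?powR_gt0 ?ltr0n.
(* The radius scale k / 8 leaves room for the passage to the modulus (factor 2),
   for the choice of centres inside the set (factor 2), and for
   scale k <= 2 * scale k.+1. *)
have s0 : 0 < scale k / 8 by rewrite divr_gt0 ?scale_gt0.
have [S [sS _ hS]] := perceptron_cover (L0 * 2 ^ k)%N Q0 s0 hQ.
pose D (i : 'rV[R]_N * 'rV[R]_N) : set 'rV[R]_N := [set f | small_set f /\
  forall p s, `|cval U (f - i.1 - i.2) p s| <= scale k / 8].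
have [v [sv v1 v2]] := pick_net D [seq (g, b) | g <- w, b <- S].
exists v; split.
- apply: leq_trans sv _; rewrite size_allpairs sS expnS mul2n -addnn mulnDr expnD.
  by rewrite leq_mul2r sw orbT.
- by move=> g /v1[i _ []].
move=> f Ff; have [g gw fg] := w2 f Ff.
have [|b bS fgb] := hS (f - g).
  apply: le_trans (energy_close (scale_gt0 k) Ff (w1 _ gw) fg) _.
  rewrite natrM natrX.
  have -> : L0%:R * 2 ^+ k * ((scale k / 8) ^+ 2 / (A `^ r / n%:R)) =
     scale k `^ (2 - r) * (L0%:R / 64 * n%:R).
    rewrite expr_div_n -(powR_split r) ?scale_gt0// scale_pow.
    field.
    by rewrite !gt_eqF ?powR_gt0 ?exprn_gt0 ?ltr0n.
  rewrite ler_wpM2l ?powR_ge0// ler_wpM2r//.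
  rewrite ler_pdivlMr//; apply: le_trans hL0; rewrite le_eqVlt; apply/orP; left; apply/eqP; ring.
have [h hv [Fh hh]] := v2 (g, b) f (allpairs_f _ gw bS) (conj Ff fgb).
exists h; first exact: hv.
move=> p; have hs := scale_half k.
apply: le_trans (_ : (scale k / 4) *+ 2 <= _); last by rewrite -mulr_natr; lra.
apply: modl_le_cval => s.
have -> : f - h = (f - g - b) - (h - g - b).
  by rewrite -!(addrA _ (- g)) -opprD opprB addrA subrK.
rewrite cvalB; apply: le_trans (ler_normB _ _) _.
have h1 := fgb p s; have /= h2 := hh p s; lra.
Qed.

End nets.

(** * Sums of random signs *)

Section signs.
Context {R : realType} {I : finType}.
Implicit Types (e : {ffun I -> bool}) (c : I -> R).

Definition sgb (b : bool) : R := if b then 1 else - 1.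

Definition rademacher c e : R := \sum_i sgb (e i) * c i.

(** Probability of an event for independent uniform signs. *)
Definition pr (Q : pred {ffun I -> bool}) : R :=
  (\sum_e (Q e)%:R) / 2 ^+ #|I|.

(** The weak constant 2 in the exponent makes the inequality 1 + x <= exp x
    sufficient for the proof. *)
Lemma cosh_le (x : R) : expR x + expR (- x) <= 2 * expR (2 * x ^+ 2).
Proof.
have small (y : R) : y ^+ 2 < 2^-1 -> expR y <= (1 - y)^-1.
  move=> y2; have y1 : y < 1.
    by rewrite ltNge; apply/negP => h; have := @ler_pM _ 1 y 1 y; rewrite -expr2; lra.
  rewrite -[expR y]invrK -expRN lef_pV2 ?posrE ?subr_gt0 ?expR_gt0//.
  exact: expR_ge1Dx.
have [x2|x2] := ltP (x ^+ 2) 2^-1.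
  have h1 := small x x2; have h2 := small (- x); rewrite sqrrN opprK in h2.
  have {}h2 := h2 x2.
  have hx : -1 < x < 1.
    have := @ltr_norml _ x 1 => <-.
    by rewrite -(@ltr_pXn2r _ 2) ?nnegrE// real_normK ?num_real// expr1n; lra.
  have h3 : (1 - x)^-1 + (1 + x)^-1 <= 2 * (1 + 2 * x ^+ 2).
    have -> : (1 - x)^-1 + (1 + x)^-1 = 2 / (1 - x ^+ 2).
      field; apply/and3P; split; apply/eqP; nra.
    rewrite ler_pdivrMr; last by lra.
    have := sqr_ge0 x; nra.
  have := expR_ge1Dx (2 * x ^+ 2); lra.
have hx : `|x| <= 2 * x ^+ 2.
  have := real_normK (num_real x); have := normr_ge0 x; nra.
have h1 : expR x <= expR (2 * x ^+ 2).
  by rewrite ler_expR (le_trans (ler_norm x)).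
have h2 : expR (- x) <= expR (2 * x ^+ 2).
  by rewrite ler_expR; apply: le_trans hx; rewrite -normrN ler_norm.
lra.
Qed.

Lemma sum_expR_rademacher (t : R) c :
  \sum_e expR (t * rademacher c e) <= 2 ^+ #|I| * expR (2 * t ^+ 2 * \sum_i c i ^+ 2).
Proof.
have -> : \sum_e expR (t * rademacher c e) =
  \prod_i \sum_(b : bool) expR (t * (sgb b * c i)).
  rewrite bigA_distr_bigA; apply: eq_bigr => e _.
  by rewrite /rademacher mulr_sumr expR_sum.
have -> : 2 ^+ #|I| * expR (2 * t ^+ 2 * \sum_i c i ^+ 2) =
  \prod_i (2 * expR (2 * (t * c i) ^+ 2)).
  rewrite big_split/= prodr_const -expR_sum; congr (_ * expR _).
  by rewrite mulr_sumr; apply: eq_bigr => i _; ring.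
apply: ler_prod => i _; apply/andP; split.
  by apply: sumr_ge0 => *; exact: expR_ge0.
by rewrite big_bool /sgb /= mul1r mulN1r mulrN cosh_le.
Qed.

Lemma hoeffding c (v s : R) : 0 < v -> 0 <= s -> \sum_i c i ^+ 2 <= v ->
  pr (fun e => s < `|rademacher c e|) <= 2 * expR (- (s ^+ 2 / (8 * v))).
Proof.
move=> v0 s0 cv.
pose t := s / (4 * v).
have t0 : 0 <= t by rewrite divr_ge0// mulr_ge0// ltW.
have main (c' : I -> R) : \sum_i c' i ^+ 2 <= v ->
  \sum_e (s < rademacher c' e)%R%:R <= 2 ^+ #|I| * expR (- (s ^+ 2 / (8 * v))).
  move=> cv'.
  apply: le_trans (_ : \sum_e (expR (t * rademacher c' e) * expR (- (t * s))) <= _).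
    apply: ler_sum => e _; have [h|_] := boolP (s < rademacher c' e); last by rewrite mulr_ge0 ?expR_ge0.
    by rewrite -expRD -[leLHS]expR0 ler_expR subr_ge0 ler_wpM2l// ltW.
  rewrite -mulr_suml.
  apply: le_trans (_ : 2 ^+ #|I| * expR (2 * t ^+ 2 * v) * expR (- (t * s)) <= _).
    rewrite ler_wpM2r ?expR_ge0//; apply: le_trans (sum_expR_rademacher _ _) _.
    by rewrite ler_wpM2l ?exprn_ge0// ler_expR ler_wpM2l// mulr_ge0// sqr_ge0.
  rewrite -mulrA -expRD ler_wpM2l ?exprn_ge0// ler_expR le_eqVlt.
  by apply/orP; left; apply/eqP; rewrite /t; field; rewrite gt_eqF.
rewrite /pr ler_pdivrMr ?exprn_gt0//.
apply: le_trans (_ : \sum_e ((s < rademacher c e)%R%:R + (s < rademacher (fun i => - c i) e)%R%:R) <= _).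
  apply: ler_sum => e _.
  have -> : rademacher (fun i => - c i) e = - rademacher c e.
    by rewrite /rademacher -sumrN; apply: eq_bigr => i _; rewrite mulrN.
  have [h|//] := boolP (s < `|_|); last by rewrite addr_ge0.
  move: h; rewrite lter_normr.
  by case/orP => -> /=; rewrite ?lerDl ?lerDr.
rewrite big_split/=.
have h1 := main c cv.
have h2 := main (fun i => - c i); move: h2.
rewrite (eq_bigr (fun i => c i ^+ 2)); last by move=> i _; rewrite sqrrN.
move=> /(_ cv); lra.
Qed.

Lemma pr_union (J : eqType) (s : seq J) (Q : pred {ffun I -> bool})
    (D : J -> pred {ffun I -> bool}) :
  (forall e, Q e -> exists2 j, j \in s & D j e) -> pr Q <= \sum_(j <- s) pr (D j).
Proof.
move=> h; rewrite /pr -mulr_suml ler_pM2r ?invr_gt0 ?exprn_gt0//.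
rewrite exchange_big/=; apply: ler_sum => e _.
have [/h[j js Dj]|_] := boolP (Q e); last exact: sumr_ge0.
by rewrite (big_rem j)//= Dj lerDl sumr_ge0.
Qed.

Lemma pr_exists (Q1 Q2 : pred {ffun I -> bool}) : pr Q1 < 2^-1 -> pr Q2 < 2^-1 ->
  exists e, ~~ Q1 e /\ ~~ Q2 e.
Proof.
move=> h1 h2; apply: contrapT => /forallNP h.
have : 1 <= pr Q1 + pr Q2.
  rewrite /pr -mulrDl ler_pdivlMr ?exprn_gt0// mul1r -big_split/=.
  have -> : 2 ^+ #|I| = \sum_(e : {ffun I -> bool}) (1 : R).
    by rewrite sumr_const card_ffun card_bool natrX.
  apply: ler_sum => e _; have := h e.
  by case: (Q1 e); case: (Q2 e) => // ; rewrite ?lerDl ?lerDr// => -[].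
lra.
Qed.

End signs.

(** * Chaining for one halving step *)

Lemma sum_pair_bool (R : nmodType) (I : finType) (F : I * bool -> R) :
  \sum_p F p = \sum_i (F (i, true) + F (i, false)).
Proof.
rewrite (eq_bigr (fun i => \sum_b F (i, b))); last by move=> i _; rewrite big_bool.
by rewrite pair_bigA; apply: eq_bigr => -[].
Qed.

Section halving.
Context {R : realType} {N : nat} {I : finType}.
Variable U : I * bool -> bool -> 'cV[R]_N.
Variables (Phi : R -> R) (A H alpha kappa r : R) (l L0 : nat).
Implicit Types (c f g : 'rV[R]_N).

Notation n := (#|{: I * bool}|).
Notation modl := (modl U).

Hypothesis A0 : 0 < A.
Hypothesis H0 : 0 < H.
Hypothesis alpha0 : 0 < alpha.
Hypothesis r12 : 1 <= r <= 2.
Hypothesis Phi0 : Phi 0 = 0.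
Hypothesis Phi_ge0 : forall t : R, 0 <= t -> 0 <= Phi t.
Hypothesis hQ : forall c p, modl c p ^+ 2 <= A `^ r / n%:R * energy U c.
Hypothesis hk : forall t : R, 0 <= t -> t `^ r <= kappa * (1 + Phi t).
Hypothesis ha : forall s t : R, 0 <= s <= A -> 0 <= t <= A ->
  (Phi t - Phi s) ^+ 2 <= alpha * `|t - s| `^ r * (Phi s + Phi t) * (H / A `^ r).
Hypothesis hL0 : 1536 * kappa <= L0%:R.
Hypothesis l0 : (0 < l)%N.
Hypothesis nl : n = (2 ^ l)%N.

Notation small := (small_set U Phi A).
Notation scale := (scale A r).

(** The change of Phi(|f|) across the pair i: its signed sum is twice the change
    of the sum of Phi(|f|) over one point of each pair, compared with half of
    the sum over all points. *)
Definition jump c (i : I) : R := Phi (modl c (i, true)) - Phi (modl c (i, false)).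

(** A link of level k violates its threshold with probability at most
    2 exp (- (8 L0 + 3) l 2^k), while the links are at most exp (8 L0 l 2^k). *)
Definition theta : R := 64 * alpha * (8 * L0%:R + 3).
(** Half of the relative error of one halving step. *)
Definition omega : R := Num.sqrt (theta * H * l%:R ^+ 3 / n%:R).

Let n_gt0 : (0 < n%:R :> R).
Proof. by rewrite nl ltr0n expn_gt0. Qed.

Let l_ge1 : 1 <= l%:R :> R.
Proof. by rewrite ler1n. Qed.

Lemma theta_gt : 4 * alpha <= theta.
Proof.
rewrite /theta; have : 0 <= alpha * L0%:R by rewrite mulr_ge0// ltW.
have -> : 64 * alpha * (8 * L0%:R + 3) = 512 * (alpha * L0%:R) + 192 * alpha by ring.
by move: alpha0; lra.
Qed.

Lemma sqr_omega : omega ^+ 2 = theta * H * l%:R ^+ 3 / n%:R.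
Proof.
rewrite sqr_sqrtr//; apply: divr_ge0; last exact: ltW.
rewrite mulr_ge0 ?exprn_ge0// mulr_ge0// ?(ltW H0)//.
by apply: le_trans theta_gt; rewrite mulr_ge0// ltW.
Qed.

(** The factor 1 / 2^k comes from scale k ^ r = A^r / 2^k in the Hoelder-type
    bound for Phi. *)
Lemma sum_sqr_diff f g k : small f -> small g ->
  (forall p, modl (f - g) p <= scale k) ->
  \sum_p (Phi (modl f p) - Phi (modl g p)) ^+ 2 <= 4 * alpha * n%:R * H / 2 ^+ k.
Proof.
move=> [fA f2] [gA g2] fg.
apply: le_trans (_ : \sum_p alpha * H / 2 ^+ k * (Phi (modl g p) + Phi (modl f p)) <= _).
  apply: ler_sum => p _.
  have h1 : 0 <= modl g p <= A by rewrite modl_ge0 gA.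
  have h2 : 0 <= modl f p <= A by rewrite modl_ge0 fA.
  apply: le_trans (ha h1 h2) _.
  have -> : alpha * H / 2 ^+ k = alpha * scale k `^ r * (H / A `^ r).
    rewrite scale_pow//; field.
    by rewrite !gt_eqF ?powR_gt0 ?exprn_gt0.
  rewrite mulrAC ler_wpM2r ?addr_ge0 ?Phi_ge0 ?modl_ge0//.
  rewrite ler_wpM2r ?divr_ge0 ?powR_ge0 ?(ltW H0)//.
  rewrite ler_wpM2l ?(ltW alpha0)//.
  apply: ge0_ler_powR; rewrite ?nnegrE ?normr_ge0//.
  - by case/andP: r12; lra.
  - by rewrite ltW// scale_gt0.
  - exact: le_trans (modl_dist _ _ _ _) (fg p).
rewrite -mulr_sumr big_split/=.
have -> : 4 * alpha * n%:R * H / 2 ^+ k = alpha * H / 2 ^+ k * (4 * n%:R) by ring.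
rewrite ler_wpM2l ?divr_ge0 ?mulr_ge0 ?(ltW alpha0) ?(ltW H0) ?exprn_ge0//.
lra.
Qed.

Lemma sum_sqr_jump f g k : small f -> small g ->
  (forall p, modl (f - g) p <= scale k) ->
  \sum_i (jump f i - jump g i) ^+ 2 <= 8 * alpha * n%:R * H / 2 ^+ k.
Proof.
move=> Ff Fg fg; have := sum_sqr_diff Ff Fg fg.
rewrite sum_pair_bool.
move=> h; apply: le_trans (_ : 2 * (4 * alpha * n%:R * H / 2 ^+ k) <= _); last first.
  by rewrite le_eqVlt; apply/orP; left; apply/eqP; ring.
apply: le_trans (_ : 2 * \sum_i ((Phi (modl f (i, true)) - Phi (modl g (i, true))) ^+ 2 +
    (Phi (modl f (i, false)) - Phi (modl g (i, false))) ^+ 2) <= _).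
  rewrite mulr_sumr; apply: ler_sum => i _; rewrite /jump/=.
  set x := Phi _; set y := Phi _; set z := Phi _; set t := Phi _.
  have := sqr_ge0 ((x - z) + (y - t)); lra.
by rewrite ler_pM2l.
Qed.

Lemma rademacherB (u v : I -> R) e :
  rademacher u e - rademacher v e = rademacher (fun i => u i - v i) e.
Proof. by rewrite /rademacher -sumrB; apply: eq_bigr => i _; rewrite mulrBr. Qed.

(** At the last level k = l the trivial bound by the l1 norm is affordable: the
    sum of squares carries a factor 1 / 2^l = 1 / n, which pays for the
    Cauchy-Schwarz inequality over n points. *)
Lemma end_term f g e : small f -> small g ->
  (forall p, modl (f - g) p <= scale l) ->
  `|rademacher (jump f) e - rademacher (jump g) e| <= n%:R * omega.
Proof.
move=> Ff Fg fg; have := sum_sqr_diff Ff Fg fg.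
rewrite rademacherB.
have -> : 4 * alpha * n%:R * H / 2 ^+ l = 4 * alpha * H.
  by rewrite nl natrX; field; rewrite gt_eqF ?exprn_gt0.
move=> h.
(* Cauchy-Schwarz in the form |d| <= d^2 / (2 tau) + tau / 2 with optimal tau. *)
pose tau := Num.sqrt (4 * alpha * H / n%:R).
have a0 : 0 < 4 * alpha * H by rewrite !mulr_gt0.
have tau0 : 0 < tau by rewrite sqrtr_gt0 divr_gt0.
have tau2 : tau ^+ 2 = 4 * alpha * H / n%:R by rewrite sqr_sqrtr// divr_ge0// ltW.
apply: le_trans (_ : n%:R * tau <= _); last first.
  rewrite ler_pM2l// ler_wsqrtr// ler_wpM2r// ?invr_ge0 ?(ltW n_gt0)//.
  apply: le_trans (_ : theta * H <= _); first by rewrite ler_pM2r// theta_gt.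
  rewrite -[leLHS]mulr1 ler_wpM2l//; last by rewrite exprn_ege1.
  rewrite mulr_ge0// ?(ltW H0)//; apply: le_trans theta_gt; rewrite mulr_ge0// ltW//.
apply: le_trans (ler_norm_sum _ _ _) _.
apply: le_trans (_ : \sum_p `|Phi (modl f p) - Phi (modl g p)| <= _).
  rewrite sum_pair_bool.
  apply: ler_sum => i _; rewrite normrM /jump/=.
  have -> : `|sgb (e i)| = 1 :> R by rewrite /sgb; case: (e i); rewrite ?normrN normr1.
  rewrite mul1r opprB addrACA [X in _ + X]addrC.
  apply: le_trans (_ : `|(Phi (modl f (i, true)) - Phi (modl g (i, true)))
    - (Phi (modl f (i, false)) - Phi (modl g (i, false)))| <= _).
    by rewrite le_eqVlt; apply/orP; left; apply/eqP; congr `|_|; ring.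
  exact: ler_normB.
apply: le_trans (_ : \sum_p ((Phi (modl f p) - Phi (modl g p)) ^+ 2 / (2 * tau) + tau / 2) <= _).
  apply: ler_sum => p _; set d := _ - _.
  have -> : d ^+ 2 / (2 * tau) + tau / 2 = (`|d| ^+ 2 + tau ^+ 2) / (2 * tau).
    by rewrite real_normK ?num_real//; field; rewrite gt_eqF.
  rewrite ler_pdivlMr ?mulr_gt0//; have := sqr_ge0 (`|d| - tau); lra.
rewrite big_split/= -mulr_suml sumr_const -[_ *+ #|_|]mulr_natl.
apply: le_trans (_ : 4 * alpha * H / (2 * tau) + n%:R * (tau / 2) <= _).
  by rewrite lerD2r ler_wpM2r// invr_ge0 mulr_ge0// ltW.
have -> : 4 * alpha * H = tau ^+ 2 * n%:R by rewrite tau2 divfK// gt_eqF.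
rewrite le_eqVlt; apply/orP; left; apply/eqP; field; rewrite gt_eqF//.
Qed.

Lemma four_n_exp : (4 * n).+1%:R <= expR (4 * l%:R) :> R.
Proof.
apply: le_trans (_ : 16 ^+ l <= _).
  rewrite -natrX ler_nat nl.
  have h : (2 ^ l >= 2)%N by rewrite -{1}(expn1 2) leq_exp2l.
  have -> : (16 ^ l = 2 ^ l * 2 ^ l * (2 ^ l * 2 ^ l))%N by rewrite -!expnMn.
  have h4 : (4 <= 2 ^ l * 2 ^ l)%N by rewrite (@leq_mul 2 2).
  have h8 : ((4 * 2 ^ l).+1 <= 8 * 2 ^ l)%N.
    by rewrite -[8%N]/(4 + 4)%N mulnDl -addn1 leq_add2l muln_gt0 expn_gt0.
  apply: leq_trans h8 _.
  have -> : (8 = 4 * 2)%N by [].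
  rewrite -mulnA leq_mul// leq_mul//.
rewrite mulrC expRM_natl lerXn2r ?nnegrE ?expR_ge0//.
have h1 : 2 <= expR (1 : R) by apply: le_trans (expR_ge1Dx _); lra.
have -> : expR (4 : R) = expR 1 ^+ 4 by rewrite -expRM_natl mulr1.
have -> : 16 = 2 ^+ 4 :> R by ring.
by rewrite lerXn2r ?nnegrE ?expR_ge0.
Qed.

Lemma exp_l_pow2 k : expR (- (3 * l%:R * 2 ^+ k)) <= 8^-1 ^+ k.+1 :> R.
Proof.
have h1 : expR (- 3) <= 8^-1 :> R.
  rewrite expRN lef_pV2 ?posrE ?expR_gt0//.
  have h : 2 <= expR (1 : R) by apply: le_trans (expR_ge1Dx _); lra.
  have -> : expR (3 : R) = expR 1 ^+ 3 by rewrite -expRM_natl mulr1.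
  have -> : 8 = 2 ^+ 3 :> R by ring.
  by rewrite lerXn2r ?nnegrE ?expR_ge0.
apply: le_trans (_ : expR (- 3) ^+ k.+1 <= _); last first.
  by rewrite lerXn2r ?nnegrE ?expR_ge0.
rewrite -expRM_natl ler_expR mulrN lerN2 [leLHS]mulrC -mulrA ler_wpM2l//.
apply: le_trans (_ : 2 ^+ k <= _); last by rewrite ler_peMl ?exprn_ge0.
by rewrite -natrX ler_nat ltn_expl.
Qed.

(** Union bound over the links of one level; the failure probabilities decay
    geometrically in k, which makes them summable with sum below 1/2. *)
Lemma level_tail (w : seq 'rV[R]_N) (k : nat) (v : 'rV[R]_N -> 'rV[R]_N) :
  (size w <= (4 * n).+1 ^ (L0 * 2 ^ k.+1))%N ->
  (forall g, g \in w -> small g /\ small (v g) /\ forall p, modl (g - v g) p <= scale k) ->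
  \sum_(g <- w) pr (fun e => n%:R * omega / l%:R <
     `|rademacher (fun i => jump g i - jump (v g) i) e|) <= 2 * 8^-1 ^+ k.+1 :> R.
Proof.
move=> sw hw.
pose E : R := expR (- ((8 * L0%:R + 3) * l%:R * 2 ^+ k)).
apply: le_trans (_ : \sum_(g <- w) 2 * E <= _).
  rewrite big_seq [leRHS]big_seq; apply: ler_sum => g gw.
  have [Fg [Fv gv]] := hw g gw.
  apply: le_trans (hoeffding _ _ (sum_sqr_jump Fg Fv gv)) _.
  - by rewrite divr_gt0 ?exprn_gt0// !mulr_gt0.
  - by rewrite divr_ge0// mulr_ge0 ?sqrtr_ge0.
  rewrite ler_pM2l// ler_expR le_eqVlt; apply/orP; left; apply/eqP; congr (- _).
  rewrite expr_div_n exprMn sqr_omega /theta; field.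
  by rewrite !gt_eqF ?exprn_gt0// ltr0n.
rewrite big_const_seq count_predT iter_addr_0 -[_ *+ size w]mulr_natr.
rewrite -mulrA ler_pM2l//.
apply: le_trans (exp_l_pow2 k).
apply: le_trans (_ : E * expR (4 * l%:R) ^+ (L0 * 2 ^ k.+1) <= _).
  rewrite ler_wpM2l ?expR_ge0//.
  apply: le_trans (_ : (4 * n).+1%:R ^+ (L0 * 2 ^ k.+1) <= _).
    by rewrite -natrX ler_nat.
  by rewrite lerXn2r ?nnegrE ?expR_ge0// four_n_exp.
rewrite -expRM_natl -expRD ler_expR natrM natrX exprS.
by rewrite le_eqVlt; apply/orP; left; apply/eqP; ring.
Qed.

(** Chaining: f is linked to a point of the net of level l, which is linked to a
    point of level l - 1, and so on down to 0.  Since each link starts at a point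
    of the finer net, there are as many links as points in that net. *)
Lemma halving : pr (fun e => `[< exists c, small c /\
   2 * n%:R * omega < `|rademacher (jump c) e| >]) < 2^-1 :> R.
Proof.
have n0 : (0 < n)%N by rewrite nl expn_gt0.
pose w0 k := projT1 (cid (nets A0 r12 n0 Phi0 hQ hk hL0 k)).
(* The chain must end at 0, where the process vanishes. *)
pose w k := if k is 0 then [:: 0] else w0 k.
have [wsz wsm wnear] : [/\
    forall k, (size (w k) <= (4 * n).+1 ^ (L0 * 2 ^ k))%N,
    forall k g, g \in w k -> small g &
    forall k f, small f -> exists2 g, g \in w k & forall p, modl (f - g) p <= scale k].
  have h k := projT2 (cid (nets A0 r12 n0 Phi0 hQ hk hL0 k)).
  split=> -[|k].
  - by rewrite /= expn_gt0.
  - by have [] := h k.+1.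
  - by move=> g; rewrite inE => /eqP ->; exact: small_set0.
  - by have [_ + _] := h k.+1.
  - by move=> f [fA _]; exists 0; rewrite ?inE// => p; rewrite subr0 scale0.
  - by have [_ _ +] := h k.+1.
pose near k f := xget 0 [set g | g \in w k /\ forall p, modl (f - g) p <= scale k].
have nearP k f : small f -> near k f \in w k /\ forall p, modl (f - near k f) p <= scale k.
  move=> Ff; apply: (@xgetPex _ 0 [set g | g \in w k /\ forall p, modl (f - g) p <= scale k]).
  by have [g gw fg] := wnear k f Ff; exists g.
pose s := n%:R * omega / l%:R.
pose D k (g : 'rV[R]_N) (e : {ffun I -> bool}) :=
  s < `|rademacher (fun i => jump g i - jump (near k g) i) e|.
apply: le_lt_trans (_ : \sum_(k <- iota 0 l) 2 * 8^-1 ^+ k.+1 < _ :> R); last first.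
  have -> : \sum_(k <- iota 0 l) 2 * 8^-1 ^+ k.+1 = 2 / 7 * (1 - 8^-1 ^+ l) :> R.
    elim: l => [|m IH]; first by rewrite big_nil subrr mulr0.
    by rewrite -addn1 iotaD big_cat big_seq1 IH add0n addn1 exprS /=; field.
  have : 0 < 8^-1 ^+ l :> R by rewrite exprn_gt0// invr_gt0.
  lra.
apply: le_trans (_ : \sum_(k <- iota 0 l) pr (fun e => has (fun g => D k g e) (w k.+1)) <= _);
    last first.
  apply: ler_sum => k _.
  apply: le_trans (_ : \sum_(g <- w k.+1) pr (D k g) <= _).
    by apply: pr_union => e /hasP[g gw Dg]; exists g.
  apply: level_tail => // g gw; have Fg := wsm _ _ gw.
  have [nw gn] := nearP k g Fg; split=> //; split=> //; exact: wsm nw.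
apply: pr_union => e /asboolP[c [Fc]].
apply: contraPP => noD.
have {}noD k g : (k < l)%N -> g \in w k.+1 ->
    `|rademacher (jump g) e - rademacher (jump (near k g)) e| <= s.
  move=> kl gw; rewrite rademacherB leNgt; apply/negP => Dg; apply: noD.
  by exists k; [rewrite mem_iota|apply/hasP; exists g].
have step k : (k <= l)%N -> forall g, g \in w k -> `|rademacher (jump g) e| <= k%:R * s.
  elim: k => [_ g|k IH kl g gw].
    rewrite inE => /eqP ->; rewrite mul0r /rademacher big1 ?normr0// => i _.
    by rewrite /jump !modl0 subrr mulr0.
  have [nw _] := nearP k g (wsm _ _ gw).
  have h1 := noD k g kl gw; have h2 := IH (ltnW kl) _ nw.
  rewrite -[rademacher _ _](subrK (rademacher (jump (near k g)) e)).
  apply: le_trans (ler_normD _ _) _.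
  by rewrite -natr1 mulrDl mul1r addrC lerD.
have [gw cg] := nearP l c Fc.
have h1 := step l (leqnn l) _ gw.
have h2 := end_term e Fc (wsm _ _ gw) cg.
have sl : l%:R * s = n%:R * omega by rewrite /s mulrC divfK// gt_eqF// ltr0n.
apply/negP; rewrite -leNgt.
rewrite -[rademacher _ _](subrK (rademacher (jump (near l c)) e)).
apply: le_trans (ler_normD _ _) _; rewrite sl in h1; lra.
Qed.

End halving.

(** * Growth of the function Phi *)

Section Phi_facts.
Context {R : realType}.
Variables (Phi : R -> R) (q r : R).
Hypothesis Phi0 : Phi 0 = 0.
Hypothesis Phi_gt0 : forall t : R, 0 < t -> 0 < Phi t.
Hypothesis r12 : 1 <= r <= 2.
Hypothesis q1 : 1 <= q.
Hypothesis Phi_r : pos_increasing (fun t => Phi t * t `^ (- r)).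
Hypothesis Phi_q : pos_decreasing (fun t => Phi t * t `^ (- q)).

Lemma Phi_nonneg (t : R) : 0 <= t -> 0 <= Phi t.
Proof. by rewrite le_eqVlt => /orP[/eqP <-|/Phi_gt0/ltW//]; rewrite Phi0. Qed.

Lemma Phi_div_pow (s t : R) : 0 < s -> s <= t -> Phi s / s `^ r <= Phi t / t `^ r.
Proof. by move=> s0 st; have := Phi_r s0 st; rewrite !powRN. Qed.

(** Phi(t) / t^q decreases. *)
Lemma Phi_mul_pow (x t : R) : 0 <= x <= 1 -> 0 <= t -> x `^ q * Phi t <= Phi (x * t).
Proof.
move=> /andP[]; rewrite le_eqVlt => /orP[/eqP <- _ _|x0 x1].
  by rewrite powR0 ?mul0r ?mul0r ?Phi0// gt_eqF// (lt_le_trans _ q1).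
rewrite le_eqVlt => /orP[/eqP <-|t0]; first by rewrite mulr0 Phi0 mulr0.
have xt0 : 0 < x * t by rewrite mulr_gt0.
have := Phi_q xt0 (_ : x * t <= t).
rewrite ger_pMl// => /(_ x1).
rewrite !powRN ler_pdivrMr ?powR_gt0// powRM ?(ltW x0) ?(ltW t0)//.
rewrite mulrC => h; rewrite -(ler_pM2l (_ : 0 < (x `^ q)^-1)) ?invr_gt0 ?powR_gt0//.
rewrite mulrA mulVf ?mul1r ?gt_eqF ?powR_gt0//.
apply: le_trans h _; rewrite le_eqVlt; apply/orP; left; apply/eqP.
by field; rewrite !gt_eqF ?powR_gt0.
Qed.

Lemma Phi_mono (s t : R) : 0 <= s -> s <= t -> Phi s <= Phi t.
Proof.
rewrite le_eqVlt => /orP[/eqP <- st|s0 st]; first by rewrite Phi0 Phi_nonneg.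
have t0 := lt_le_trans s0 st.
have := Phi_div_pow s0 st; rewrite ler_pdivrMr ?powR_gt0// => h.
apply: le_trans h _; rewrite mulrAC -mulrA ler_piMr ?(ltW (Phi_gt0 t0))//.
rewrite ler_pdivrMr ?powR_gt0// mul1r.
by apply: ge0_ler_powR; rewrite ?nnegrE ?(ltW s0) ?(ltW t0)//; case/andP: r12; lra.
Qed.

(** Bernoulli's inequality with a factor 2, from ln x >= 1 - 1/x when x >= 1/2. *)
Lemma one_sub_powR (x : R) : 0 <= x <= 1 -> 1 - x `^ q <= 2 * q * (1 - x).
Proof.
move=> /andP[x0 x1]; have xq := powR_ge0 x q.
have [x2|x2] := leP x 2^-1.
  have : (1 : R) <= q * (2 * (1 - x)).
    by rewrite -[leLHS]mulr1; apply: ler_pM => //; lra.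
  lra.
have {}x0 : 0 < x by lra.
have h : x `^ q >= 1 + q * ln x.
  by rewrite /powR gt_eqF//; exact: expR_ge1Dx.
have hl : - ln x <= x^-1 - 1.
  have xi : 0 < x^-1 by rewrite invr_gt0.
  rewrite -lnV ?posrE//; have := @le_ln1Dx R (x^-1 - 1).
  by rewrite [1 + _]addrC subrK; apply; lra.
have hx : x^-1 - 1 <= 2 * (1 - x).
  have -> : x^-1 - 1 = x^-1 * (1 - x) by field; rewrite gt_eqF.
  rewrite ler_wpM2r ?subr_ge0//; rewrite -[leRHS]invrK lef_pV2 ?posrE//; lra.
have : q * (- ln x) <= q * (2 * (1 - x)).
  by apply: ler_wpM2l; [exact: le_trans ler01 q1|exact: le_trans hl hx].
lra.
Qed.

(** With x = s/t, Phi(t) - Phi(s) <= 2 q (1 - x) Phi(t) by the q-growth; then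
    (1 - x)^2 <= (1 - x)^r as r <= 2, and Phi(t)/t^r <= Phi(A)/A^r. *)
Lemma Phi_holder (A s t : R) : 0 < A -> 0 <= s <= A -> 0 <= t <= A ->
  (Phi t - Phi s) ^+ 2 <=
  4 * q ^+ 2 * `|t - s| `^ r * (Phi s + Phi t) * (Phi A / A `^ r).
Proof.
move=> A0; wlog st : s t / s <= t => [hw|].
  move=> hs ht; have [st|/ltW ts] := leP s t; first exact: hw.
  by rewrite -sqrrN opprB distrC [Phi s + _]addrC; exact: hw.
move=> /andP[s0 sA] /andP[t0 tA]; have [r1 r2] := andP r12.
have q0 : 0 <= q := le_trans ler01 q1.
have B0 : 0 <= Phi A / A `^ r by rewrite divr_ge0 ?powR_ge0// Phi_nonneg// ltW.
have [tE|tN] := eqVneq t 0.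
  have sE : s = 0 by apply/eqP; rewrite eq_le s0 -tE st.
  by rewrite tE sE Phi0 subrr expr0n/= addr0 mulr0 mul0r.
have {}t0 : 0 < t by rewrite lt_neqAle eq_sym tN.
pose x := s / t.
have x01 : 0 <= x <= 1 by rewrite divr_ge0 ?(ltW t0)//= ler_pdivrMr// mul1r.
have xt : x * t = s by rewrite /x divfK.
have h1 := Phi_mul_pow x01 (ltW t0); rewrite xt in h1.
have h2 := one_sub_powR x01.
have Pt := Phi_gt0 t0.
have d0 : 0 <= Phi t - Phi s by rewrite subr_ge0 Phi_mono.
have h3 : Phi t - Phi s <= Phi t * (2 * q * (1 - x)).
  apply: le_trans (_ : Phi t * (1 - x `^ q) <= _); last by rewrite ler_pM2l.
  lra.
have u0 : 0 <= 1 - x by case/andP: x01; lra.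
have h4 : (Phi t - Phi s) ^+ 2 <= (Phi t * (2 * q * (1 - x))) ^+ 2.
  by rewrite ler_sqr ?nnegrE ?mulr_ge0// ltW.
apply: le_trans h4 _.
have h5 : (1 - x) ^+ 2 <= (t - s) `^ r / t `^ r.
  have -> : (t - s) `^ r / t `^ r = (1 - x) `^ r.
    have -> : t - s = t * (1 - x) by rewrite mulrBr mulr1 [t * x]mulrC xt.
    rewrite powRM ?(ltW t0)//; field; rewrite gt_eqF ?powR_gt0//.
  have [->|uN] := eqVneq (1 - x) 0; first by rewrite expr0n/= powR_ge0.
  have ugt : 0 < 1 - x by rewrite lt_neqAle eq_sym uN.
  rewrite -(@powR_split _ r)// ler_piMl ?powR_ge0//.
  have e1 : (1 : R) `^ (2 - r) = 1 by rewrite powR1.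
  rewrite -[leRHS]e1; apply: ge0_ler_powR; rewrite ?nnegrE ?subr_ge0//; by case/andP: x01; lra.
have h6 := Phi_div_pow t0 tA.
apply: le_trans (_ : 4 * q ^+ 2 * (Phi t ^+ 2 * (1 - x) ^+ 2) <= _).
  by rewrite le_eqVlt; apply/orP; left; apply/eqP; ring.
rewrite -2!(mulrA (4 * q ^+ 2)) ler_wpM2l ?mulr_ge0 ?sqr_ge0//.
rewrite ger0_norm ?subr_ge0//.
apply: le_trans (_ : Phi t ^+ 2 * ((t - s) `^ r / t `^ r) <= _).
  by rewrite ler_wpM2l ?sqr_ge0.
have -> : Phi t ^+ 2 * ((t - s) `^ r / t `^ r) = (t - s) `^ r * (Phi t * (Phi t / t `^ r)) by ring.
rewrite -mulrA ler_wpM2l ?powR_ge0//.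
apply: ler_pM; rewrite ?(ltW Pt) ?divr_ge0 ?powR_ge0 ?(ltW Pt)//.
by rewrite lerDr Phi_nonneg.
Qed.

Lemma pow_le_Phi (t : R) : 0 <= t -> t `^ r <= (1 + (Phi 1)^-1) * (1 + Phi t).
Proof.
move=> t0; have P1 := Phi_gt0 ltr01; have [r1 r2] := andP r12.
have iP : 0 < (Phi 1)^-1 by rewrite invr_gt0.
have Pt := Phi_nonneg t0.
have [t1|t1] := leP t 1.
  apply: le_trans (_ : 1 <= _).
    have e1 : (1 : R) `^ r = 1 by rewrite powR1.
    rewrite -[leRHS]e1; apply: ge0_ler_powR; rewrite ?nnegrE//; lra.
  rewrite -[leLHS]mulr1; apply: ler_pM => //; lra.
have := Phi_div_pow ltr01 (ltW t1); rewrite powR1 divr1.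
rewrite ler_pdivlMr ?powR_gt0 ?(lt_trans ltr01 t1)//.
move=> h; have {h} : t `^ r <= (Phi 1)^-1 * Phi t.
  by rewrite -(ler_pM2l P1) mulrA divff ?gt_eqF// mul1r.
have := mulr_ge0 (ltW iP) Pt; lra.
Qed.

End Phi_facts.

Section square.
Context {R : realType}.

Lemma sqr_holder (A s t : R) : 0 < A -> 0 <= s <= A -> 0 <= t <= A ->
  (t ^+ 2 - s ^+ 2) ^+ 2 <=
  2 * `|t - s| `^ 2 * (s ^+ 2 + t ^+ 2) * (A ^+ 2 / A `^ 2).
Proof.
move=> A0 _ _; rewrite !powR_mulrn ?(ltW A0)// divff ?gt_eqF ?exprn_gt0// mulr1.
rewrite real_normK ?num_real// subr_sqr exprMn.
have -> : 2 * (t - s) ^+ 2 * (s ^+ 2 + t ^+ 2) = (t - s) ^+ 2 * (2 * (s ^+ 2 + t ^+ 2)) by ring.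
rewrite ler_wpM2l ?sqr_ge0//; have := sqr_ge0 (t - s); lra.
Qed.

End square.

(** * Iterated halving of a point set *)

(** Index sets of 2^l points, defined so that 2^(l+1) indices are by definition
    2^l pairs. *)
Fixpoint cube (l : nat) : finType :=
  if l is l'.+1 then (cube l' * bool)%type : finType else unit.

Lemma card_cube l : #|cube l| = (2 ^ l)%N.
Proof.
elim: l => [|l IH]; first exact: card_unit.
by rewrite /= card_prod card_bool IH expnS mulnC.
Qed.

(** An integer above 1536 k: the base length of the codes of the nets. *)
Definition code_length {R : realType} (k : R) : nat := (Num.trunc (1536 * k)).+1.

Lemma code_lengthP {R : realType} (k : R) : 1536 * k <= (code_length k)%:R.
Proof. by rewrite ltW// truncnS_gt. Qed.

Section core.
Context {R : realType} {N : nat} {T : Type}.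
Variables (Omega : set T) (U : T -> bool -> 'cV[R]_N).
Variables (Phi : R -> R) (q r M A : R) (IPhi I2 : 'rV[R]_N -> R).
Implicit Types (c : 'rV[R]_N).

Hypothesis Phi0 : Phi 0 = 0.
Hypothesis Phi_gt0 : forall t : R, 0 < t -> 0 < Phi t.
Hypothesis r12 : 1 <= r <= 2.
Hypothesis q1 : 1 <= q.
Hypothesis Phi_r : pos_increasing (fun t => Phi t * t `^ (- r)).
Hypothesis Phi_q : pos_decreasing (fun t => Phi t * t `^ (- q)).
Hypothesis M1 : 1 <= M.
Hypothesis A0 : 0 < A.
Hypothesis AM : 2 * M <= A `^ r.
Hypothesis I2Z : forall a c, I2 (a *: c) = a ^+ 2 * I2 c.
Hypothesis I2_ge0 : forall c, 0 <= I2 c.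
Hypothesis nikolskii : forall c x, Omega x -> modl U c x ^+ 2 <= M * I2 c.
Hypothesis IPhi_sup : forall c x, Omega x -> IPhi c <= 1 -> modl U c x <= A.

Definition avg (F : R -> R) l (y : cube l -> T) c : R :=
  (\sum_p F (modl U c (y p))) / 2 ^+ l.

(** The second modular, with t^2 in place of Phi, is carried along because the
    next halving needs the sup norm to be controlled by the empirical L2 norm. *)
Definition samples (err : R) l (y : cube l -> T) :=
  [/\ forall p, Omega (y p),
      forall c, IPhi c <= 1 -> `|avg Phi y c - IPhi c| <= err &
      forall c, I2 c <= 1 -> `|avg (fun t => t ^+ 2) y c - I2 c| <= err].

Definition kap : R := 1 + (Phi 1)^-1.
(** Dominates the constants of both halvings; the factor 1 / Phi(1) converts the
    bound in terms of M for t^2 into one in terms of Phi(A). *)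
Definition Theta : R :=
  theta (4 * q ^+ 2) (code_length kap) + theta 2 (code_length (1 : R)) * (Phi 1)^-1.
(** Error of the passage from 2^l points to 2^(l-1). *)
Definition delta l : R := 2 * Num.sqrt (Theta * Phi A * l%:R ^+ 3 / 2 ^+ l).

Let P1 : 0 < Phi 1. Proof. exact: Phi_gt0. Qed.

Lemma theta_ge0 (a : R) k : 0 <= a -> 0 <= theta a k.
Proof. by move=> a0; rewrite /theta !mulr_ge0// addr_ge0// mulr_ge0. Qed.

Lemma Theta_ge : theta (4 * q ^+ 2) (code_length kap) <= Theta.
Proof.
by rewrite /Theta lerDl mulr_ge0 ?theta_ge0 ?invr_ge0 ?(ltW P1).
Qed.

Lemma Theta_ge0 : 0 <= Theta.
Proof.
apply: addr_ge0; first by apply: theta_ge0; rewrite mulr_ge0 ?sqr_ge0.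
by apply: mulr_ge0; [exact: theta_ge0|rewrite invr_ge0 ltW].
Qed.

(** This is why the cost of preserving the L2 norm is absorbed by that of the
    modular. *)
Lemma PhiA_ge : Phi 1 * (2 * M) <= Phi A.
Proof.
have A1 : 1 <= A.
  rewrite leNgt; apply/negP => A1.
  have : A `^ r <= 1.
    have e1 : (1 : R) `^ r = 1 by rewrite powR1.
    rewrite -[leRHS]e1; apply: ge0_ler_powR; rewrite ?nnegrE ?(ltW A0) ?(ltW A1)//.
    by case/andP: r12; lra.
  by move: AM M1; lra.
have := Phi_div_pow Phi_r ltr01 A1; rewrite powR1 divr1 ler_pdivlMr ?powR_gt0//.
by apply: le_trans; rewrite ler_pM2l.
Qed.

Lemma delta_ge l (H a : R) k : 0 <= H -> 0 <= a -> theta a k * H <= Theta * Phi A ->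
  2 * Num.sqrt (theta a k * H * l%:R ^+ 3 / 2 ^+ l) <= delta l.
Proof.
move=> H0 a0 h; rewrite /delta ler_pM2l// ler_wsqrtr//.
by rewrite ler_wpM2r ?invr_ge0 ?exprn_ge0// ler_wpM2r ?exprn_ge0.
Qed.

Lemma avg_half (F : R -> R) l (y : cube l.+1 -> T) c (e : {ffun cube l -> bool}) :
  avg F (fun i : cube l => y (i, e i)) c - avg F y c =
  rademacher (jump (fun p => U (y p)) F c) e / 2 ^+ l.+1.
Proof.
rewrite /avg.
rewrite [X in _ - X / _](@sum_pair_bool R (cube l) (fun p => F (modl U c (y p)))).
have -> : \sum_p F (modl U c (y (p, e p))) =
  (\sum_i (F (modl U c (y (i, true))) + F (modl U c (y (i, false))))
    + rademacher (jump (fun p => U (y p)) F c) e) / 2.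
  rewrite /rademacher -big_split/= mulr_suml; apply: eq_bigr => i _.
  rewrite /jump /sgb -/(modl U c (y (i, true))) -/(modl U c (y (i, false))).
  by case: (e i); rewrite ?mul1r ?mulN1r; field.
by rewrite exprS; field; rewrite gt_eqF ?exprn_gt0.
Qed.

(** The empirical L2 norm controls the L2 norm up to a factor 2, by homogeneity;
    so the Nikolskii inequality passes to the points with constant 2 M, and both
    halvings are possible with the same signs. *)
Lemma samples_half err l (y : cube l.+1 -> T) : err <= 2^-1 -> samples err y ->
  exists y' : cube l -> T, samples (err + delta l.+1) y'.
Proof.
move=> err2 [yO yPhi y2].
pose n := #|{: cube l * bool}|.
have nE : n = (2 ^ l.+1)%N by rewrite -card_cube.
have nR : n%:R = 2 ^+ l.+1 :> R by rewrite nE natrX.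
pose V (p : cube l * bool) := U (y p).
have PA0 : 0 < Phi A by apply: Phi_gt0.
have I2_avg c : I2 c <= 2 * avg (fun t => t ^+ 2) y c.
  have [c0|cN] := eqVneq (I2 c) 0.
    by rewrite c0 mulr_ge0// divr_ge0 ?exprn_ge0// sumr_ge0// => *; rewrite sqr_ge0.
  have c0 : 0 < I2 c by rewrite lt_neqAle eq_sym cN I2_ge0.
  (* The sampling property holds on the ball only; rescale c to its boundary. *)
  pose a := (Num.sqrt (I2 c))^-1.
  have a2 : a ^+ 2 = (I2 c)^-1 by rewrite exprVn sqr_sqrtr ?I2_ge0.
  have h1 : I2 (a *: c) = 1 by rewrite I2Z a2 mulVf.
  have := y2 (a *: c); rewrite h1 => /(_ (lexx _)).
  have -> : avg (fun t => t ^+ 2) y (a *: c) = a ^+ 2 * avg (fun t => t ^+ 2) y c.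
    rewrite /avg mulrA; congr (_ / _); rewrite mulr_sumr; apply: eq_bigr => p _.
    by rewrite modlZ exprMn real_normK ?num_real.
  rewrite a2 ler_norml => /andP[h2 _].
  have h3 : 2^-1 <= (I2 c)^-1 * avg (fun t => t ^+ 2) y c by lra.
  have := ler_wpM2l (ltW c0) h3; rewrite mulrA divff// mul1r; lra.
have nik c p : modl V c p ^+ 2 <= 2 * M / n%:R * energy V c.
  apply: le_trans (nikolskii c (yO p)) _.
  have -> : 2 * M / n%:R * energy V c = M * (2 * avg (fun t => t ^+ 2) y c).
    by rewrite /avg nR /energy; ring.
  by rewrite ler_pM2l// (lt_le_trans ltr01 M1).
have E0 c : 0 <= energy V c by apply: energy_ge0.
have h1 : pr (fun e => `[< exists c, small_set V Phi A c /\
   2 * n%:R * omega (I := cube l) (Phi A) (4 * q ^+ 2) l.+1 (code_length kap) <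
     `|rademacher (jump V Phi c) e| >]) < 2^-1 :> R.
  apply: (halving (kappa := kap) A0 PA0 _ r12 Phi0).
  - by rewrite mulr_gt0// exprn_gt0// (lt_le_trans ltr01 q1).
  - exact: Phi_nonneg.
  - move=> c p; apply: le_trans (nik c p) _.
    by rewrite ler_wpM2r// ler_wpM2r// invr_ge0.
  - exact: pow_le_Phi.
  - by move=> s t hs ht; apply: (Phi_holder Phi0 Phi_gt0 r12 q1 Phi_r Phi_q A0 hs ht).
  - exact: code_lengthP.
  - by [].
  - exact: nE.
have A2 : 0 < Num.sqrt (2 * M).
  by rewrite sqrtr_gt0 mulr_gt0// (lt_le_trans ltr01 M1).
have M20 : 0 <= 2 * M by rewrite mulr_ge0// (le_trans ler01 M1).
have A22 : Num.sqrt (2 * M) ^+ 2 = 2 * M by rewrite sqr_sqrtr.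
have h2 : pr (fun e => `[< exists c, small_set V (fun t => t ^+ 2) (Num.sqrt (2 * M)) c /\
   2 * n%:R * omega (I := cube l) (2 * M) 2 l.+1 (code_length (1 : R)) <
     `|rademacher (jump V (fun t => t ^+ 2) c) e| >]) < 2^-1 :> R.
  apply: (halving (kappa := 1) (r := 2) A2) => //.
  - by rewrite mulr_gt0// (lt_le_trans ltr01 M1).
  - by apply/andP; split; lra.
  - by rewrite expr0n.
  - by move=> t _; exact: sqr_ge0.
  - by move=> c p; rewrite powR_mulrn ?(ltW A2)// A22.
  - by move=> t t0; rewrite powR_mulrn// mul1r lerDr.
  - by move=> s t hs ht; have := sqr_holder A2 hs ht; rewrite A22.
  - exact: code_lengthP.
have [e [/asboolP/forallNP e1 /asboolP/forallNP e2]] := pr_exists h1 h2.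
exists (fun i : cube l => y (i, e i)); split => [p|c Ic|c Ic]; first exact: yO.
- have avg2 : \sum_p Phi (modl V c p) <= 2 * n%:R.
    have -> : \sum_p Phi (modl V c p) = avg Phi y c * n%:R.
      by rewrite /avg nR divfK// gt_eqF ?exprn_gt0.
    rewrite ler_wpM2r//; have := yPhi c Ic; rewrite ler_norml => /andP[_]; lra.
  have bd : `|rademacher (jump V Phi c) e| <=
      2 * n%:R * omega (I := cube l) (Phi A) (4 * q ^+ 2) l.+1 (code_length kap).
    rewrite leNgt; apply/negP => hb; apply: (e1 c); split => //; split => // p.
    exact: IPhi_sup.
  rewrite -(subrK (avg Phi y c) (avg Phi _ c)) -addrA addrC.
  apply: le_trans (ler_normD _ _) _; apply: lerD; first exact: yPhi.
  rewrite avg_half normrM [ `|_^-1|]ger0_norm ?invr_ge0 ?exprn_ge0// ler_pdivrMr ?exprn_gt0//.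
  apply: le_trans bd _; rewrite -nR mulrAC ler_wpM2r// /omega -/n nR.
  by apply: delta_ge; [exact: ltW|rewrite mulr_ge0 ?sqr_ge0|rewrite ler_pM2r// Theta_ge].
- have avg2 : \sum_p (modl V c p) ^+ 2 <= 2 * n%:R.
    have -> : \sum_p (modl V c p) ^+ 2 = avg (fun t => t ^+ 2) y c * n%:R.
      by rewrite /avg nR divfK// gt_eqF ?exprn_gt0.
    rewrite ler_wpM2r//; have := y2 c Ic; rewrite ler_norml => /andP[_]; lra.
  have bd : `|rademacher (jump V (fun t => t ^+ 2) c) e| <=
      2 * n%:R * omega (I := cube l) (2 * M) 2 l.+1 (code_length (1 : R)).
    rewrite leNgt; apply/negP => hb; apply: (e2 c); split => //; split => // p.
    rewrite -ler_sqr ?nnegrE ?modl_ge0 ?(ltW A2)// A22.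
    apply: le_trans (nikolskii c (yO p)) _; apply: le_trans (_ : M * 1 <= _).
      by rewrite ler_wpM2l// (le_trans ler01 M1).
    by move: M1; lra.
  rewrite -(subrK (avg (fun t => t ^+ 2) y c) (avg _ _ c)) -addrA addrC.
  apply: le_trans (ler_normD _ _) _; apply: lerD; first exact: y2.
  rewrite avg_half normrM [ `|_^-1|]ger0_norm ?invr_ge0 ?exprn_ge0// ler_pdivrMr ?exprn_gt0//.
  apply: le_trans bd _; rewrite -nR mulrAC ler_wpM2r// /omega -/n nR.
  apply: delta_ge => //.
  apply: le_trans (_ : theta 2 (code_length (1 : R)) * ((Phi 1)^-1 * Phi A) <= _).
    rewrite ler_wpM2l ?theta_ge0// [leRHS]mulrC ler_pdivlMr// [leLHS]mulrC.
    exact: PhiA_ge.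
  by rewrite mulrA ler_pM2r// /Theta lerDr theta_ge0// mulr_ge0 ?sqr_ge0.
Qed.

(** (9/8)^3 / 2 < (9/10)^2. *)
Lemma delta_step l : (8 <= l)%N -> delta l.+1 <= 9 / 10 * delta l.
Proof.
move=> l8; rewrite /delta [leRHS]mulrCA ler_pM2l//.
have PA0 : 0 < Phi A by apply: Phi_gt0.
have TA : 0 <= Theta * Phi A by rewrite mulr_ge0 ?Theta_ge0// ltW.
have D0 k : 0 <= Theta * Phi A * k%:R ^+ 3 / 2 ^+ k.
  by rewrite divr_ge0 ?exprn_ge0// mulr_ge0// exprn_ge0.
rewrite -ler_sqr ?nnegrE ?mulr_ge0 ?sqrtr_ge0 ?divr_ge0//.
rewrite exprMn !sqr_sqrtr//.
have -> : Theta * Phi A * l.+1%:R ^+ 3 / 2 ^+ l.+1 =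
   (Theta * Phi A / 2 ^+ l) * (l.+1%:R ^+ 3 / 2).
  by rewrite (exprS _ l); field; rewrite gt_eqF ?exprn_gt0.
have -> : (9 / 10) ^+ 2 * (Theta * Phi A * l%:R ^+ 3 / 2 ^+ l) =
   (Theta * Phi A / 2 ^+ l) * ((9 / 10) ^+ 2 * l%:R ^+ 3) by ring.
rewrite ler_wpM2l ?divr_ge0 ?exprn_ge0//.
have l8R : 8 <= l%:R :> R by rewrite (ler_nat _ 8).
have h : l.+1%:R <= 9 / 8 * l%:R :> R by rewrite -natr1; lra.
have : l.+1%:R ^+ 3 <= (9 / 8 * l%:R) ^+ 3 :> R.
  by rewrite lerXn2r ?nnegrE// mulr_ge0// divr_ge0.
rewrite exprMn; have : 0 <= l%:R ^+ 3 :> R by rewrite exprn_ge0.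
lra.
Qed.

(** Summing the geometric series of errors from the top: 10 * 9/10 + 1 = 10. *)
Lemma samples_descend err k l (y : cube (l + k) -> T) : (8 <= l)%N ->
  err + 10 * delta l.+1 <= 2^-1 -> samples err y ->
  exists y' : cube l -> T, samples (err + 10 * delta l.+1) y'.
Proof.
have D0 j : 0 <= delta j by rewrite mulr_ge0 ?sqrtr_ge0.
elim: k l y => [|k IH] l y l8 el sy.
  rewrite addn0 in y sy; exists y; case: sy => [yO yP y2]; split => // c /[dup] h.
    by move=> /yP/le_trans; apply; rewrite lerDl mulr_ge0.
  by move=> /y2/le_trans; apply; rewrite lerDl mulr_ge0.
rewrite addnS -addSn in y sy.
have ds := delta_step (leqW l8); have := D0 l.+1 => d1.
have [||y1 sy1] := IH _ y _ _ sy; [exact: leqW|lra|].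
have [|y' [y'O y'P y'2]] := samples_half _ sy1; first by lra.
exists y'; split => // c h.
  by apply: le_trans (y'P c h) _; lra.
by apply: le_trans (y'2 c h) _; lra.
Qed.

Hypothesis quantization : forall dl : R, 0 < dl -> exists l0, forall l, (l0 <= l)%N ->
  exists y : cube l -> T, samples dl y.

(** The number of halvings does not matter, so the initial number of points may
    depend on everything. *)
Lemma core_sampling l eps : (8 <= l)%N -> 0 < eps <= 2^-1 ->
  1600 * Theta * Phi A * l%:R ^+ 3 <= eps ^+ 2 * 2 ^+ l ->
  exists y : cube l -> T, (forall p, Omega (y p)) /\
    forall c, IPhi c <= 1 -> `|avg Phi y c - IPhi c| <= eps.
Proof.
move=> l8 /andP[e0 e2] hl.
have PA0 : 0 < Phi A by apply: Phi_gt0.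
have TA : 0 <= Theta * Phi A by rewrite mulr_ge0 ?Theta_ge0// ltW.
(* 1600 = (20 * 2)^2: half of eps is left for the quantization error. *)
have dl : 20 * delta l <= eps.
  rewrite /delta mulrA -ler_sqr ?nnegrE ?(ltW e0) ?mulr_ge0 ?sqrtr_ge0//.
  rewrite exprMn sqr_sqrtr; last by rewrite divr_ge0 ?exprn_ge0// mulr_ge0 ?exprn_ge0.
  rewrite !mulrA ler_pdivrMr ?exprn_gt0//; apply: le_trans hl.
  by rewrite le_eqVlt; apply/orP; left; apply/eqP; ring.
have ds := delta_step l8.
have e4 : 0 < eps / 2 by rewrite divr_gt0.
have [l0 hq] := quantization e4.
have [y sy] := hq (l + l0)%N (leq_addl _ _).
have d0 : 0 <= delta l by rewrite mulr_ge0 ?sqrtr_ge0.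
have hd : eps / 2 + 10 * delta l.+1 <= eps by lra.
have [|y' [yO yP _]] := samples_descend l8 _ sy; first by lra.
by exists y'; split => // c /yP/le_trans; apply.
Qed.

End core.

(** * From weights to points *)

Section near_constant.
Context {disp : measure_display} {T : measurableType disp} {R : realType}.
Variable mu : {measure set T -> \bar R}.

Lemma integral_near_cst (C : set T) (h : T -> R) (a eta : R) :
  measurable C -> mu C \is a fin_num -> measurable_fun C h -> 0 <= a -> 0 <= eta ->
  (forall x, C x -> 0 <= h x) -> (forall x, C x -> `|h x - a| <= eta) ->
  (\int[mu]_(x in C) (h x)%:E \is a fin_num)%E /\
  `|fine (\int[mu]_(x in C) (h x)%:E) - a * fine (mu C)| <= eta * fine (mu C).
Proof.
move=> mC fC mh a0 eta0 h0 ha.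
have mE : measurable_fun C (EFin \o h) by apply/measurable_EFinP.
have up : (\int[mu]_(x in C) (h x)%:E <= (a + eta)%:E * mu C)%E.
  rewrite -integral_cst//; apply: ge0_le_integral => //.
  move=> x Cx /=; rewrite lee_fin.
  by have := ha x Cx; rewrite ler_norml => /andP[_]; lra.
have lo : (a%:E * mu C <= \int[mu]_(x in C) (h x)%:E + eta%:E * mu C)%E.
  rewrite -!integral_cst// -ge0_integralD//.
  apply: ge0_le_integral => //.
  - by apply: emeasurable_funD => //; exact: measurable_cst.
  - move=> x Cx /=; rewrite lee_fin.
    by have := ha x Cx; rewrite ler_norml => /andP[]; lra.
have I0 : (0 <= \int[mu]_(x in C) (h x)%:E)%E.
  by apply: integral_ge0 => x Cx; rewrite lee_fin h0.
have fI : (\int[mu]_(x in C) (h x)%:E \is a fin_num)%E.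
  rewrite ge0_fin_numE//; apply: le_lt_trans up _.
  by rewrite -(fineK fC) -EFinM ltry.
split => //.
move: up lo; rewrite -(fineK fC) -(fineK fI) -!EFinM -EFinD !lee_fin /= => up lo.
rewrite ler_norml; apply/andP; split; lra.
Qed.

End near_constant.

Section weights.
Context {R : realType} {T : Type}.

(** The weight of the n-th point is rounded to the difference of the integer parts
    of consecutive cumulated weights; these differences add up to 2^l exactly and
    each is off by less than 1. *)
Lemma count_weights (w : nat -> R) (xs : nat -> T) (Omega : set T) (L l : nat) :
  (forall n, 0 <= w n) -> \sum_(n < L) w n = 1 -> (forall n, (n < L)%N -> Omega (xs n)) ->
  exists y : cube l -> T, (forall p, Omega (y p)) /\
    forall (F : T -> R) (B : R), (forall n, (n < L)%N -> `|F (xs n)| <= B) ->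
    `|(\sum_p F (y p)) / 2 ^+ l - \sum_(n < L) w n * F (xs n)| <= L%:R * B / 2 ^+ l.
Proof.
move=> w0 w1 xO.
pose W n : R := 2 ^+ l * \sum_(k < n) w k.
have W0 n : 0 <= W n by rewrite mulr_ge0 ?exprn_ge0 ?sumr_ge0.
have WS n : W n.+1 = W n + 2 ^+ l * w n by rewrite /W big_ord_recr/= mulrDr.
pose t n := Num.trunc (W n).
have tP n : (t n)%:R <= W n < (t n).+1%:R by exact: truncn_itv.
have tS n : (t n <= t n.+1)%N.
  by apply: le_truncn; rewrite WS lerDl mulr_ge0 ?exprn_ge0.
pose cnt n := (t n.+1 - t n)%N.
have sum_cnt m : (\sum_(n < m) cnt n = t m)%N.
  elim: m => [|m IH]; last by rewrite big_ord_recr/= IH subnKC.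
  by rewrite big_ord0 /t /W big_ord0 mulr0 truncn0.
have tL : t L = (2 ^ l)%N by rewrite /t /W w1 mulr1 -natrX natrK.
pose s := flatten [seq nseq (cnt n) (xs n) | n <- iota 0 L].
have sz : size s = #|cube l|.
  rewrite card_cube -tL -sum_cnt size_flatten /shape -map_comp sumnE big_map.
  rewrite -(big_mkord xpredT cnt) /index_iota subn0.
  by apply: eq_bigr => n _; rewrite /= size_nseq.
have sO z : List.In z s -> Omega z.
  rewrite /s; have : forall n, n \in iota 0 L -> Omega (xs n).
    by move=> n; rewrite mem_iota => /andP[_]; exact: xO.
  elim: (iota 0 L) => [|n v IH] hv //= zv.
  case: (@List.in_app_or _ _ _ _ zv) => [|/IH]; last first.
    by apply => m mv; apply: hv; rewrite inE mv orbT.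
  have := hv n (mem_head _ _).
  by elim: (cnt n) => //= m IH' On [<-//|]; exact: IH'.
have [L0|L0] := posnP L.
  by move: w1; rewrite L0 big_ord0 => /esym/eqP; rewrite oner_eq0.
pose x0 := xs 0%N.
exists (fun p => nth x0 s (enum_rank p)); split.
  move=> p; apply: sO; have : (enum_rank p < size s)%N by rewrite sz.
  move: (nat_of_ord _) => i; elim: (s) i => //= a v IH [|i] h; first by left.
  by right; exact: IH.
move=> F B hF.
have -> : \sum_(p : cube l) F (nth x0 s (enum_rank p)) = \sum_(n < L) (cnt n)%:R * F (xs n).
  have -> : \sum_(p : cube l) F (nth x0 s (enum_rank p)) = \sum_(z <- s) F z.
    rewrite (big_nth x0) sz big_mkord.
    by rewrite [RHS](reindex (@enum_rank (cube l)))//; exact/onW_bij/enum_rank_bij.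
  rewrite /s big_flatten big_map -(big_mkord xpredT (fun n => (cnt n)%:R * F (xs n))).
  rewrite /index_iota subn0; apply: eq_bigr => n _.
  by rewrite big_nseq iter_addr_0 mulr_natl.
rewrite mulr_suml -sumrB; apply: le_trans (ler_norm_sum _ _ _) _.
apply: le_trans (_ : \sum_(n < L) B / 2 ^+ l <= _); last first.
  by rewrite sumr_const card_ord -[_ *+ L]mulr_natl mulrA.
apply: ler_sum => n _.
have -> : (cnt n)%:R * F (xs n) / 2 ^+ l - w n * F (xs n) =
    ((cnt n)%:R - 2 ^+ l * w n) * F (xs n) / 2 ^+ l.
  by field; rewrite gt_eqF ?exprn_gt0.
rewrite normrM [ `|_^-1|]ger0_norm ?invr_ge0 ?exprn_ge0// ler_wpM2r ?invr_ge0 ?exprn_ge0//.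
rewrite normrM -[leRHS]mul1r; apply: ler_pM => //; last exact: hF.
rewrite /cnt natrB//.
have := tP n; have := tP n.+1; rewrite WS -!natr1 => /andP[h1 h2] /andP[h3 h4].
rewrite ler_norml; apply/andP; split; lra.
Qed.

End weights.

(** * Continuity relative to a compact set *)

Section relative_continuity.
Context {R : realType} {T : ptopologicalType}.
Variable Omega : set T.
Notation BT := (g_sigma_algebraType (@open T)).

(** Continuity of the restriction to Omega, in the form which yields both open
    covers of Omega and Borel measurability on Omega. *)
Definition rcont (h : T -> R) := forall x, Omega x -> forall e, 0 < e ->
  \forall y \near x, Omega y -> `|h y - h x| < e.

Hypothesis clO : closed Omega.

Lemma closed_borel (A : set T) : closed A -> measurable (A : set BT).
Proof.
move=> cA; rewrite -[A]setCK; apply: measurableC.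
by apply: sub_sigma_algebra; exact: closed_openC.
Qed.

Lemma rcont_measurable h : rcont h -> measurable_fun (Omega : set BT) (h : BT -> R).
Proof.
move=> ch; apply: (measurability _ (RGenOInfty.measurableE R)).
move=> _ [_ [a ->] <-].
have -> : Omega `&` h @^-1` `]a, +oo[%classic =
    Omega `&` interior [set y | Omega y -> a < h y].
  apply/seteqP; split => x [Ox] /=.
    rewrite in_itv/= andbT => ax; split => //.
    have := ch x Ox (h x - a); rewrite subr_gt0 => /(_ ax).
    apply: filterS => y hy Oy; have := hy Oy; rewrite ltr_norml => /andP[h1 _]; lra.
  by move=> /interior_subset /(_ Ox) ax; split => //=; rewrite in_itv/= andbT.
apply: measurableI; first exact: closed_borel.
by apply: sub_sigma_algebra; exact: open_interior.
Qed.

Context {N : nat}.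
Variable U : T -> bool -> 'cV[R]_N.
Hypothesis cU : forall s k, rcont (fun x => U x s k 0).

Lemma rcont_joint x e : Omega x -> 0 < e ->
  \forall y \near x, Omega y -> forall s k, `|U y s k 0 - U x s k 0| < e.
Proof.
move=> Ox e0.
have : \forall y \near x, forall i : bool * 'I_N, Omega y -> `|U y i.1 i.2 0 - U x i.1 i.2 0| < e.
  by apply: filter_forall => -[s k]; exact: cU.
by apply: filterS => y h Oy s k; exact: (h (s, k)).
Qed.

(** A family of evaluation functionals of maximal rank spans all the others. *)
Lemma spanning_rows : exists (m : nat) (W : 'M[R]_(m, N)),
  (forall i, exists x s, Omega x /\ row i W = (U x s)^T) /\
  forall x s, Omega x -> ((U x s)^T <= W)%MS.
Proof.
pose Q k := `[< exists (m : nat) (W : 'M[R]_(m, N)),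
  (forall i, exists x s, Omega x /\ row i W = (U x s)^T) /\ \rank W = k >].
have exQ : exists k, Q k.
  exists 0%N; apply/asboolP; exists 0%N, 0; split; first by case.
  by rewrite mxrank0.
have ubQ k : Q k -> (k <= N)%N by move=> /asboolP[m [W [_ <-]]]; exact: rank_leq_col.
have [k /asboolP[m [W [hW rW]]] maxk] := ex_maxnP exQ ubQ.
exists m, W; split => // x s Ox.
have sub : (W <= col_mx W (U x s)^T)%MS by rewrite -addsmxE addsmxSl.
have := mxrank_leqif_sup sub; case=> le1; rewrite col_mx_sub submx_refl /= => <-.
rewrite eqn_leq le1 /= rW; apply: maxk; apply/asboolP.
exists (m + 1)%N, (col_mx W (U x s)^T); split => // i.
case: (split_ordP i) => j ->; first by rewrite rowKu.
rewrite rowKd; exists x, s; split => //.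
by apply/matrixP => a b; rewrite !mxE (ord1 j) (ord1 a).
Qed.

(** f_c is a combination, with coefficients that are values of f_c at finitely
    many points, of fixed functions; so a bound on sup |f_c| bounds the
    oscillation. *)
Lemma equicontinuity : exists2 K : R, 0 <= K & forall c S,
  (forall x, Omega x -> modl U c x <= S) -> forall x y s, Omega x -> Omega y ->
  `|cval U c y s - cval U c x s| <= K * S * \sum_k `|U y s k 0 - U x s k 0|.
Proof.
have [m [W [hW subW]]] := spanning_rows.
exists (\sum_k \sum_i `|pinvmx W k i|); first by apply: sumr_ge0 => k _; apply: sumr_ge0.
move=> c S hS x y s Ox Oy.
have S0 : 0 <= S by apply: le_trans (modl_ge0 U c x) (hS x Ox).
have key z : Omega z -> cval U c z s = ((U z s)^T *m pinvmx W *m (W *m c^T)) 0 0.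
  move=> Oz; rewrite mulmxA mulmxKpV ?subW//.
  by rewrite -trmx_mul /cval [RHS]mxE.
rewrite (key y Oy) (key x Ox).
have -> : ((U y s)^T *m pinvmx W *m (W *m c^T)) 0 0 - ((U x s)^T *m pinvmx W *m (W *m c^T)) 0 0
   = (((U y s - U x s)^T *m pinvmx W) *m (W *m c^T)) 0 0.
  by rewrite linearB/= !mulmxBl [RHS]mxE [X in _ = _ + X]mxE.
rewrite mxE; apply: le_trans (ler_norm_sum _ _ _) _.
apply: le_trans (_ : \sum_i (\sum_k `|U y s k 0 - U x s k 0| * `|pinvmx W k i|) * S <= _).
  apply: ler_sum => i _; rewrite normrM; apply: ler_pM => //.
    rewrite mxE; apply: le_trans (ler_norm_sum _ _ _) _.
    by apply: ler_sum => k _; rewrite normrM !mxE.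
  have [z [s' [Oz rz]]] := hW i.
  apply: le_trans (hS z Oz); apply: le_trans (cval_le_modl U c z s').
  have -> : (W *m c^T) i 0 = cval U c z s'.
    transitivity ((row i W *m c^T) 0 0); first by rewrite -row_mul [RHS]mxE.
    by rewrite rz -trmx_mul mxE.
  by [].
rewrite -mulr_suml mulrAC ler_wpM2r// exchange_big/= mulr_suml.
apply: ler_sum => k _; rewrite -mulr_sumr mulrC ler_wpM2l ?sumr_ge0//.
by rewrite (bigD1 k)//= lerDl sumr_ge0.
Qed.

Hypothesis coO : compact Omega.

(** A finite open subcover made disjoint.  The points xs n need not belong to the
    cells, only to be close to all of their elements. *)
Lemma finite_net (D : T -> T -> Prop) :
  (forall x, Omega x -> \forall y \near x, Omega y -> D x y) ->
  exists (L : nat) (xs : nat -> T) (C : nat -> set T),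
  [/\ forall n, (n < L)%N -> Omega (xs n),
      forall n, measurable (C n : set BT),
      trivIset setT C,
      \big[setU/set0]_(n < L) C n = Omega &
      forall n y, (n < L)%N -> C n y -> D (xs n) y].
Proof.
move=> hD.
pose O x := interior [set y | Omega y -> D x y].
have := coO; rewrite compact_cover => /(_ T Omega O) [].
- by move=> x _; exact: open_interior.
- by move=> x Ox; exists x => //; exact: hD.
move=> D' D'O cov.
pose xs := [seq x <- finmap.enum_fset D' | true].
pose x0 := head point xs.
pose F n := if (n < size xs)%N then Omega `&` O (nth x0 xs n) else set0.
exists (size xs), (nth x0 xs), (seqDU F); split.
- move=> n hn; have h : nth x0 xs n \in D' by have := mem_nth x0 hn; rewrite mem_filter.
  exact: set_mem (D'O _ h).
- apply: (@seqDU_measurable _ BT) => n; rewrite /F; case: ifP => // _.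
  apply: measurableI; first exact: closed_borel.
  by apply: sub_sigma_algebra; exact: open_interior.
- exact: trivIset_seqDU.
- rewrite -bigsetU_seqDU -bigcup_mkord; apply/seteqP; split => y.
    by move=> [n /= hn]; rewrite /F hn => -[].
  move=> Oy; have [x /= xD Oxy] := cov y Oy.
  have xs_x : x \in xs by rewrite mem_filter.
  exists (index x xs) => /=; first by rewrite index_mem.
  by rewrite /F index_mem xs_x nth_index.
- move=> n y hn Cy; have := subset_seqDU Cy; rewrite /F hn => -[Oy h]; exact: (interior_subset h Oy).
Qed.

Lemma modl_bounded c : exists2 S : R, 0 <= S & forall x, Omega x -> modl U c x <= S.
Proof.
have [L [xs [C [xO _ _ CO hC]]]] := @finite_net (fun x y => forall s k, `|U y s k 0 - U x s k 0| < 1)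
  (fun x Ox => rcont_joint Ox ltr01).
pose b := \sum_k `|c 0 k|.
have b0 : 0 <= b by apply: sumr_ge0.
exists (\sum_(n < L) modl U c (xs n) + b *+ 2).
  by rewrite addr_ge0 ?mulrn_wge0// sumr_ge0// => n _; exact: modl_ge0.
move=> x; rewrite -CO -bigcup_mkord => -[n /= nL Cx].
have close s : `|cval U c x s - cval U c (xs n) s| <= b.
  rewrite /cval !mxE -sumrB; apply: le_trans (ler_norm_sum _ _ _) _.
  apply: ler_sum => k _; rewrite -mulrBr normrM ler_piMr// ltW//; exact: hC.
have := modl_dist_points close; rewrite ler_norml => /andP[_ dist].
apply: le_trans (_ : modl U c (xs n) + b *+ 2 <= _); first by lra.
rewrite lerD2r (bigD1 (Ordinal nL))//= lerDl.
by apply: sumr_ge0 => *; exact: modl_ge0.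
Qed.

End relative_continuity.

(** * Approximation of the measure by points *)

Section quantize.
Context {R : realType} {T : ptopologicalType}.
Variable Omega : set T.
Notation BT := (g_sigma_algebraType (@open T)).
Hypothesis clO : closed Omega.
Hypothesis coO : compact Omega.
Context {N : nat}.
Variable U : T -> bool -> 'cV[R]_N.
Hypothesis cU : forall s k, rcont Omega (fun x => U x s k 0).
Variable mu : probability BT R.
Hypothesis muO : mu Omega = 1%E.

Let mO : measurable (Omega : set BT).
Proof. exact: closed_borel. Qed.

Lemma rcont_comp (h : T -> R) (F : R -> R) S :
  (forall x, Omega x -> 0 <= h x <= S) -> rcont Omega h ->
  (forall eta, 0 < eta -> exists2 tau, 0 < tau &
    forall s t, 0 <= s <= S -> 0 <= t <= S -> `|t - s| <= tau -> `|F t - F s| <= eta) ->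
  rcont Omega (fun x => F (h x)).
Proof.
move=> hS ch cF x Ox e e0.
have e2 : 0 < e / 2 by rewrite divr_gt0.
have [tau tau0 hF] := cF (e / 2) e2.
have := ch x Ox tau tau0; apply: filterS => y hy Oy.
apply: le_lt_trans (hF _ _ _ _ _) _; [exact: hS|exact: hS|exact/ltW/hy|].
by rewrite gtr_pMr//; lra.
Qed.

Lemma modl_rcont c : rcont Omega (modl U c).
Proof.
move=> x Ox e e0.
pose b := \sum_k `|c 0 k|.
have b0 : 0 <= b by apply: sumr_ge0.
have e' : 0 < e / (2 * (b + 1)) by rewrite divr_gt0// mulr_gt0//; lra.
have := rcont_joint cU Ox e'; apply: filterS => y h Oy.
apply: le_lt_trans (modl_dist_points (t := b * (e / (2 * (b + 1)))) _) _.
  move=> s; rewrite /cval !mxE -sumrB; apply: le_trans (ler_norm_sum _ _ _) _.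
  rewrite mulr_suml; apply: ler_sum => k _; rewrite -mulrBr normrM ler_wpM2l//.
  by rewrite ltW//; exact: h.
rewrite -[_ *+ 2]mulr_natr.
have -> : b * (e / (2 * (b + 1))) * 2 = e * (b / (b + 1)) by field; apply/eqP; lra.
by rewrite gtr_pMr// ltr_pdivrMr; lra.
Qed.

(** The cells depend on S and tau only, which makes the estimate uniform in c and
    F. *)
Lemma quantize S tau : 0 <= S -> 0 < tau -> exists L : nat, forall l, exists y : cube l -> T,
  (forall p, Omega (y p)) /\
  forall (F : R -> R) (B eta : R) c, (forall x, Omega x -> modl U c x <= S) ->
    measurable_fun (Omega : set BT) (fun x : BT => F (modl U c x)) -> 0 <= eta ->
    (forall t, 0 <= t <= S -> 0 <= F t <= B) ->
    (forall s t, 0 <= s <= S -> 0 <= t <= S -> `|t - s| <= tau -> `|F t - F s| <= eta) ->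
    (\int[mu]_(x in Omega) (F (modl U c x))%:E \is a fin_num)%E /\
    `|avg U F y c - fine (\int[mu]_(x in Omega) (F (modl U c x))%:E)| <=
      L%:R * B / 2 ^+ l + eta.
Proof.
move=> S0 tau0.
have [K K0 hK] := equicontinuity Omega U.
(* N components of oscillation e each change the modulus by at most tau. *)
pose e := tau / (2 * (K * S * N%:R + 1)).
have KS0 : 0 <= K * S by rewrite mulr_ge0.
have KSN : 0 <= K * S * N%:R by rewrite mulr_ge0.
have e0 : 0 < e by rewrite divr_gt0// mulr_gt0//; lra.
have [L [xs [C [xO mC tC CO hC]]]] := finite_net clO coO (fun x Ox => rcont_joint cU Ox e0).
exists L => l.
pose w n := fine (mu (C n)).
have fC n : mu (C n) \is a fin_num by exact: fin_num_measure.
have w0 n : 0 <= w n by rewrite fine_ge0.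
have tC' (s : seq nat) : trivIset [set` s] C by apply: sub_trivIset tC.
have CO' : \big[setU/set0]_(n <- index_iota 0 L) C n = Omega by rewrite big_mkord.
have intO (f : BT -> \bar R) : measurable_fun (Omega : set BT) f ->
    (forall x, Omega x -> 0 <= f x)%E ->
    (\int[mu]_(x in Omega) f x = \sum_(n < L) \int[mu]_(x in C n) f x)%E.
  move=> mf f0.
  have := @ge0_integral_bigsetU _ BT R mu nat C f (index_iota 0 L) mC (iota_uniq _ _) (tC' _).
  by rewrite /= CO' => ->//; rewrite big_mkord.
have w1 : \sum_(n < L) w n = 1.
  have := intO (cst 1%E) (measurable_cst _) (fun _ _ => lee01).
  rewrite integral_cst// mul1e => h.
  apply: EFin_inj; apply: etrans (etrans (esym h) muO); rewrite -sumEFin.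
  by apply: eq_bigr => n _; rewrite integral_cst// mul1e fineK.
have [y [yO hy]] := count_weights l w0 w1 xO.
exists y; split => // F B eta c cS mF eta0 FB Feta.
have mo x : Omega x -> 0 <= modl U c x <= S by move=> Ox; rewrite modl_ge0 cS.
have CsubO n : (n < L)%N -> C n `<=` Omega.
  by move=> nL x Cx; rewrite -CO -bigcup_mkord; exists n.
have near n x : (n < L)%N -> C n x -> `|F (modl U c x) - F (modl U c (xs n))| <= eta.
  move=> nL Cx; have Ox := CsubO n nL x Cx.
  apply: Feta; [exact/mo/xO|exact: mo|].
  apply: le_trans (modl_dist_points (t := tau / 2) _) _; last by rewrite -[_ *+ 2]mulr_natr divfK.
  move=> s; apply: le_trans (hK c S cS _ _ s (xO n nL) Ox) _.
  apply: le_trans (_ : K * S * (N%:R * e) <= _).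
    rewrite ler_wpM2l//; apply: le_trans (_ : \sum_(k < N) e <= _).
      by apply: ler_sum => k _; exact/ltW/hC.
    by rewrite sumr_const card_ord -[_ *+ N]mulr_natl.
  have -> : K * S * (N%:R * e) = tau / 2 * ((K * S * N%:R) / (K * S * N%:R + 1)).
    by rewrite /e; field; apply/eqP; lra.
  rewrite ler_piMr ?divr_ge0 ?(ltW tau0)// ler_pdivrMr; lra.
have cell (n : 'I_L) := @integral_near_cst _ BT R mu (C n) (fun x => F (modl U c x))
  (F (modl U c (xs n))) eta (mC n) (fC n)
  (measurable_funS mO (CsubO n (ltn_ord n)) mF)
  (proj1 (andP (FB _ (mo _ (xO n (ltn_ord n)))))) eta0
  (fun x Cx => proj1 (andP (FB _ (mo _ (CsubO n (ltn_ord n) x Cx)))))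
  (fun x Cx => near n x (ltn_ord n) Cx).
have intE : (\int[mu]_(x in Omega) (F (modl U c x))%:E =
    (\sum_(n < L) fine (\int[mu]_(x in C n) (F (modl U c x))%:E))%:E)%E.
  rewrite intO.
  - by rewrite -sumEFin; apply: eq_bigr => n _; rewrite fineK//; have [] := cell n.
  - by apply/measurable_EFinP.
  - by move=> x Ox; rewrite lee_fin; have /andP[] := FB _ (mo x Ox).
rewrite intE /=; split => //.
have hB n : (n < L)%N -> `|F (modl U c (xs n))| <= B.
  move=> nL; have /andP[F0 FB'] := FB _ (mo _ (xO n nL)).
  by rewrite ger0_norm.
have h1 := hy (fun x => F (modl U c x)) B hB.
apply: le_trans (ler_distD (\sum_(n < L) w n * F (modl U c (xs n))) _ _) _.
apply: lerD; first exact: h1.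
rewrite -sumrB; apply: le_trans (ler_norm_sum _ _ _) _.
rewrite -[leRHS]mulr1 -w1 mulr_sumr; apply: ler_sum => n _.
by rewrite distrC [w n * _]mulrC; have [_] := cell n.
Qed.

End quantize.

(** * Sampling of the modular *)

Section unif_cont.
Context {R : realType}.

Definition ucont_on (S : R) (F : R -> R) := forall eta, 0 < eta -> exists2 tau, 0 < tau &
  forall s t, 0 <= s <= S -> 0 <= t <= S -> `|t - s| <= tau -> `|F t - F s| <= eta.

Lemma holder_ucont (F : R -> R) S D r : 1 <= r -> 0 <= D ->
  (forall s t, 0 <= s <= S -> 0 <= t <= S -> (F t - F s) ^+ 2 <= D * `|t - s| `^ r) ->
  ucont_on S F.
Proof.
move=> r1 D0 hF eta eta0.
have t0 : 0 < eta ^+ 2 / (D + 1) by rewrite divr_gt0 ?exprn_gt0//; lra.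
exists (Num.min 1 (eta ^+ 2 / (D + 1))); first by rewrite lt_min ltr01.
move=> s t hs ht; rewrite le_min => /andP[h1 h2].
rewrite -ler_sqr ?nnegrE ?(ltW eta0)// real_normK ?num_real//.
apply: le_trans (hF s t hs ht) _.
apply: le_trans (_ : D * (eta ^+ 2 / (D + 1)) <= _).
  rewrite ler_wpM2l//; apply: le_trans h2.
  have [->|dN] := eqVneq `|t - s| 0; first by rewrite powR0// gt_eqF//; lra.
  have d0 : 0 < `|t - s| by rewrite lt_neqAle eq_sym dN normr_ge0.
  have -> : `|t - s| `^ r = `|t - s| * `|t - s| `^ (r - 1).
    rewrite -{2}(powRr1 (ltW d0)) -powRD; last by rewrite dN implybT.
    by congr (_ `^ _); ring.
  rewrite ler_piMr ?(ltW d0)//.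
  have e1 : (1 : R) `^ (r - 1) = 1 by rewrite powR1.
  by rewrite -[leRHS]e1; apply: ge0_ler_powR; rewrite ?nnegrE ?subr_ge0 ?(ltW d0).
have -> : D * (eta ^+ 2 / (D + 1)) = eta ^+ 2 * (D / (D + 1)) by field; apply/eqP; lra.
by rewrite ler_piMr ?sqr_ge0// ler_pdivrMr; lra.
Qed.

Lemma sqr_ucont S : 0 < S -> ucont_on S (fun t => t ^+ 2).
Proof.
move=> S0; apply: (@holder_ucont _ _ (4 * S ^+ 2) 2).
- by lra.
- by rewrite mulr_ge0 ?sqr_ge0.
move=> s t hs ht; apply: le_trans (sqr_holder S0 hs ht) _.
rewrite [S `^ 2]powR_mulrn ?(ltW S0)// divff ?gt_eqF ?exprn_gt0// mulr1.
rewrite mulrAC ler_wpM2r ?powR_ge0//.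
move: hs ht => /andP[s0 sS] /andP[t0 tS].
have : s ^+ 2 <= S ^+ 2 by rewrite ler_sqr ?nnegrE ?(ltW S0).
have : t ^+ 2 <= S ^+ 2 by rewrite ler_sqr ?nnegrE ?(ltW S0).
lra.
Qed.

Lemma Phi_ucont (Phi : R -> R) q r S : Phi 0 = 0 -> (forall t, 0 < t -> 0 < Phi t) ->
  1 <= r <= 2 -> 1 <= q ->
  pos_increasing (fun t => Phi t * t `^ (- r)) ->
  pos_decreasing (fun t => Phi t * t `^ (- q)) -> 0 < S -> ucont_on S Phi.
Proof.
move=> P0 Pgt r12 q1 Pr Pq S0; have [r1 r2] := andP r12.
have PS := Pgt _ S0.
apply: (@holder_ucont _ _ (4 * q ^+ 2 * (Phi S + Phi S) * (Phi S / S `^ r)) r) => //.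
  apply: mulr_ge0; last by rewrite divr_ge0 ?powR_ge0 ?(ltW PS).
  by apply: mulr_ge0; [rewrite mulr_ge0 ?sqr_ge0|rewrite addr_ge0 ?ltW].
move=> s t hs ht; apply: le_trans (Phi_holder P0 Pgt r12 q1 Pr Pq S0 hs ht) _.
have -> : 4 * q ^+ 2 * (Phi S + Phi S) * (Phi S / S `^ r) * `|t - s| `^ r =
   4 * q ^+ 2 * `|t - s| `^ r * (Phi S + Phi S) * (Phi S / S `^ r) by ring.
have B0 : 0 <= Phi S / S `^ r by rewrite divr_ge0 ?powR_ge0 ?(ltW PS).
apply: ler_wpM2r => //; apply: ler_wpM2l.
  by rewrite mulr_ge0 ?powR_ge0// mulr_ge0 ?sqr_ge0.
move: hs ht => /andP[s0 sS] /andP[t0 tS].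
by apply: lerD; apply: (Phi_mono P0 Pgt r12 Pr).
Qed.

End unif_cont.

Section sampling.
Context {R : realType} {T : ptopologicalType}.
Variable Omega : set T.
Notation BT := (g_sigma_algebraType (@open T)).
Hypothesis clO : closed Omega.
Hypothesis coO : compact Omega.
Context {N : nat}.
Variable U : T -> bool -> 'cV[R]_N.
Hypothesis cU : forall s k, rcont Omega (fun x => U x s k 0).
Variable mu : probability BT R.
Hypothesis muO : mu Omega = 1%E.
Variables (Phi : R -> R) (q r M : R).
Hypothesis Phi0 : Phi 0 = 0.
Hypothesis Phi_gt0 : forall t : R, 0 < t -> 0 < Phi t.
Hypothesis r12 : 1 <= r <= 2.
Hypothesis q1 : 1 <= q.
Hypothesis Phi_r : pos_increasing (fun t => Phi t * t `^ (- r)).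
Hypothesis Phi_q : pos_decreasing (fun t => Phi t * t `^ (- q)).
Hypothesis M1 : 1 <= M.

Definition modular (F : R -> R) c : \bar R := (\int[mu]_(x in Omega) (F (modl U c x))%:E)%E.

Hypothesis nikolskii : forall c x, Omega x ->
  ((modl U c x ^+ 2)%:E <= M%:E * modular (fun t => t ^+ 2)%R c)%E.

Let mO : measurable (Omega : set BT).
Proof. exact: closed_borel. Qed.

(** Covers Phi and t^2 at once. *)
Definition admissible (F : R -> R) := (forall S, 0 < S -> ucont_on S F) /\
  (forall s t, 0 <= s -> s <= t -> F s <= F t) /\ F 0 = 0.

Lemma sqr_admissible : admissible (fun t : R => t ^+ 2).
Proof.
split; first exact: sqr_ucont.
by split=> [s t s0 st|]; rewrite ?expr0n// ler_sqr ?nnegrE// (le_trans s0).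
Qed.

Lemma Phi_admissible : admissible Phi.
Proof.
split; first by move=> S S0; apply: (Phi_ucont Phi0 Phi_gt0 r12 q1 Phi_r Phi_q).
by split => // s t s0 st; apply: (Phi_mono Phi0 Phi_gt0 r12 Phi_r).
Qed.

Lemma admissible_ge0 F t : admissible F -> 0 <= t -> 0 <= F t.
Proof. by move=> [_ [Fi F0]] t0; rewrite -F0 Fi. Qed.

Lemma modular_measurable F c : admissible F ->
  measurable_fun (Omega : set BT) (fun x : BT => F (modl U c x)).
Proof.
move=> [Fu _]; have [S S0 hS] := modl_bounded clO cU coO c.
have S1 : 0 < S + 1 by lra.
apply: rcont_measurable => //; apply: (rcont_comp (S := S + 1) _ _ (Fu _ S1)).
  by move=> x Ox; rewrite modl_ge0 /=; have := hS x Ox; lra.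
exact: modl_rcont.
Qed.

Lemma modular_fin F c : admissible F -> modular F c \is a fin_num.
Proof.
move=> aF; have [S S0 hS] := modl_bounded clO cU coO c.
have B0 : 0 <= F S := admissible_ge0 aF S0.
have [L hL] := quantize clO coO cU muO S0 ltr01.
have [y [_ hy]] := hL 0%N.
have := hy F (F S) (F S) c hS (modular_measurable c aF) B0.
have FB t : 0 <= t <= S -> 0 <= F t <= F S.
  by move=> /andP[t0 tS]; rewrite (admissible_ge0 aF t0) aF.2.1.
case=> //.
move=> s t /FB/andP[h1 h2] /FB/andP[h3 h4] _.
by rewrite ler_norml; apply/andP; split; lra.
Qed.

Lemma modular_ge0 F c : admissible F -> (0 <= modular F c)%E.
Proof.
move=> aF; apply: integral_ge0 => x Ox; rewrite lee_fin.
by apply: admissible_ge0 => //; exact: modl_ge0.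
Qed.

Lemma modular_sqrZ a c :
  fine (modular (fun t => t ^+ 2) (a *: c)) = a ^+ 2 * fine (modular (fun t => t ^+ 2) c).
Proof.
rewrite /modular.
under eq_integral do rewrite modlZ exprMn real_normK ?num_real// EFinM.
rewrite ge0_integralZl_EFin ?sqr_ge0//.
- by rewrite fineM//; exact: (modular_fin c sqr_admissible).
- by move=> x _; rewrite lee_fin sqr_ge0.
- by apply/measurable_EFinP; exact: modular_measurable sqr_admissible.
Qed.

(** The solution A of A^r = 2 (kap + 1) M. *)
Definition sup_radius : R := (2 * (kap Phi + 1) * M) `^ r^-1.

Let kap0 : 0 < kap Phi.
Proof. by rewrite addr_gt0// invr_gt0 Phi_gt0. Qed.

Lemma sup_radius_gt0 : 0 < sup_radius.
Proof.
by rewrite powR_gt0// !mulr_gt0//; [exact: addr_gt0|exact: lt_le_trans ltr01 M1].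
Qed.

Lemma sup_radius_pow : sup_radius `^ r = 2 * (kap Phi + 1) * M.
Proof.
rewrite -powRrM mulVf ?powRr1//; last first.
  by rewrite gt_eqF//; case/andP: r12; lra.
apply: mulr_ge0; last exact: le_trans ler01 M1.
by rewrite mulr_ge0// addr_ge0// ltW.
Qed.

(** With S = sup |f|: S^2 <= M * (integral of |f|^2) and |f|^2 <= S^(2-r) |f|^r,
    so S^r <= M * (integral of |f|^r) <= 2 kap M. *)
Lemma modular_sup c x : Omega x -> (modular Phi c <= 1)%E -> modl U c x <= sup_radius.
Proof.
move=> Ox Ic; have [r1 r2] := andP r12.
have aP := Phi_admissible; have aS := sqr_admissible.
pose E := [set modl U c x | x in Omega].
have [B B0 hB] := modl_bounded clO cU coO c.
have Esup : has_sup E.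
  split; first by exists (modl U c x); exists x.
  by exists B => _ [y Oy <-]; exact: hB.
pose S := sup E.
have hS y : Omega y -> modl U c y <= S.
  by move=> Oy; apply: sup_upper_bound => //; exists y.
have S0 : 0 <= S by apply: le_trans (hS x Ox); exact: modl_ge0.
apply: le_trans (hS x Ox) _.
move: S0; rewrite le_eqVlt => /orP[/eqP <-|S0]; first exact/ltW/sup_radius_gt0.
have M0 : 0 <= M := le_trans ler01 M1.
have I2 : (modular (fun t => t ^+ 2)%R c <= (S `^ (2 - r) * kap Phi * 2)%R%:E)%E.
  apply: le_trans (_ : \int[mu]_(x in Omega) ((S `^ (2 - r) * kap Phi)%R%:E *
      (1 + (Phi (modl U c x))%:E)) <= _)%E.
    apply: ge0_le_integral => //.
    - by move=> y _; rewrite lee_fin sqr_ge0.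
    - by apply/measurable_EFinP; exact: modular_measurable aS.
    - apply: emeasurable_funM; first exact: measurable_cst.
      apply: emeasurable_funD; first exact: measurable_cst.
      by apply/measurable_EFinP; exact: modular_measurable aP.
    move=> y Oy; rewrite -EFinD -EFinM lee_fin.
    have m0 := modl_ge0 U c y.
    apply: le_trans (_ : S `^ (2 - r) * modl U c y `^ r <= _).
      move: m0; rewrite le_eqVlt => /orP[/eqP <-|m0].
        by rewrite expr0n mulr_ge0 ?powR_ge0.
      rewrite -(powR_split r m0) ler_wpM2r ?powR_ge0//.
      by apply: ge0_ler_powR; rewrite ?nnegrE ?subr_ge0 ?(ltW m0) ?(ltW S0) ?hS.
    rewrite -mulrA ler_wpM2l ?powR_ge0//.
    exact: (pow_le_Phi Phi0 Phi_gt0 r12 Phi_r).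
  have k0 : 0 <= S `^ (2 - r) * kap Phi by rewrite mulr_ge0 ?powR_ge0// ltW.
  rewrite ge0_integralZl_EFin//; first last.
  - apply: emeasurable_funD; first exact: measurable_cst.
    by apply/measurable_EFinP; exact: modular_measurable aP.
  - by move=> y Oy; rewrite -EFinD lee_fin addr_ge0// admissible_ge0// modl_ge0.
  rewrite ge0_integralD//; first last.
  - by apply/measurable_EFinP; exact: modular_measurable aP.
  - by move=> y Oy; rewrite lee_fin admissible_ge0// modl_ge0.
  rewrite integral_cst// mul1e [X in (_ * (X + _))%E](_ : _ = 1%E) ?muO//.
  rewrite (EFinM _ 2) lee_wpmul2l ?lee_fin//.
  rewrite (_ : 2%:E = 1 + 1)%E ?leeD2l//.
have S2 : S ^+ 2 <= M * (S `^ (2 - r) * kap Phi * 2).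
  have X0 : 0 <= M * (S `^ (2 - r) * kap Phi * 2).
    by rewrite !mulr_ge0 ?powR_ge0// ltW.
  rewrite -[leRHS]sqr_sqrtr// ler_sqr ?nnegrE ?sqrtr_ge0 ?(ltW S0)//.
  apply: ge_sup; first by exists (modl U c x); exists x.
  move=> _ [y Oy <-].
  rewrite -ler_sqr ?nnegrE ?sqrtr_ge0 ?modl_ge0// [Num.sqrt (M * _) ^+ 2]sqr_sqrtr// -lee_fin.
  apply: le_trans (nikolskii c Oy) _; rewrite EFinM lee_wpmul2l ?lee_fin//.
have Sr : S `^ r <= sup_radius `^ r.
  rewrite sup_radius_pow; move: S2; rewrite -(powR_split r S0).
  have -> : M * (S `^ (2 - r) * kap Phi * 2) = S `^ (2 - r) * (2 * kap Phi * M) by ring.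
  rewrite ler_pM2l ?powR_gt0// => h; apply: le_trans h _.
  by rewrite ler_wpM2r// ler_wpM2l// lerDl.
have rN : r != 0 by rewrite gt_eqF//; lra.
have inv t : 0 <= t -> (t `^ r) `^ r^-1 = t by move=> t0; rewrite -powRrM divff// powRr1.
rewrite -(inv S (ltW S0)) -(inv _ (ltW sup_radius_gt0)).
by apply: ge0_ler_powR; rewrite ?nnegrE ?powR_ge0 ?invr_ge0//; lra.
Qed.

Lemma modular_sampling l eps : (8 <= l)%N -> 0 < eps <= 2^-1 ->
  1600 * Theta Phi q * Phi sup_radius * l%:R ^+ 3 <= eps ^+ 2 * 2 ^+ l ->
  exists y : cube l -> T, (forall p, Omega (y p)) /\
    forall c, (modular Phi c <= 1)%E -> `|avg U Phi y c - fine (modular Phi c)| <= eps.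
Proof.
move=> l8 eps2 hl.
have aP := Phi_admissible; have aS := sqr_admissible.
have M0 : 0 <= M := le_trans ler01 M1.
have A0 := sup_radius_gt0.
have AM : 2 * M <= sup_radius `^ r.
  by rewrite sup_radius_pow ler_wpM2r// -[leLHS]mulr1 ler_wpM2l// lerDr ltW.
have leE F c : admissible F -> (modular F c <= 1)%E <-> fine (modular F c) <= 1.
  by move=> aF; rewrite -lee_fin fineK// modular_fin.
have nik c x : Omega x -> modl U c x ^+ 2 <= M * fine (modular (fun t => t ^+ 2) c).
  move=> Ox; rewrite -lee_fin; apply: le_trans (nikolskii c Ox) _.
  by rewrite (EFinM M) fineK//; exact: modular_fin aS.
have [||||y [yO yP]] := @core_sampling R N T Omega U Phi q r M sup_radius
  (fun c => fine (modular Phi c)) (fun c => fine (modular (fun t => t ^+ 2) c))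
  Phi0 Phi_gt0 r12 q1 Phi_r Phi_q M1 A0 AM _ _ nik _ _ l eps l8 eps2 hl.
- exact: modular_sqrZ.
- by move=> c; rewrite fine_ge0// modular_ge0.
- by move=> c x Ox /leE -/(_ aP); exact: modular_sup.
- move=> dl dl0.
  pose S := sup_radius + Num.sqrt M.
  have S0 : 0 < S by rewrite ltr_wpDr ?sqrtr_ge0.
  have dl2 : 0 < dl / 2 by rewrite divr_gt0.
  have [t1 t10 u1] := aP.1 S S0 (dl / 2) dl2.
  have [t2 t20 u2] := aS.1 S S0 (dl / 2) dl2.
  have t0 : 0 < Num.min t1 t2 by rewrite lt_min t10.
  have [L hL] := quantize clO coO cU muO (ltW S0) t0.
  pose B := Phi S + S ^+ 2.
  have PS0 : 0 <= Phi S by rewrite admissible_ge0// ltW.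
  exists (Num.trunc (L%:R * B * 2 / dl)).+1 => l' hl'.
  have small : L%:R * B / 2 ^+ l' <= dl / 2.
    rewrite ler_pdivrMr ?exprn_gt0//.
    have h1 : L%:R * B * 2 / dl <= 2 ^+ l'.
      apply: le_trans (ltW (truncnS_gt _)) _.
      by rewrite -natrX ler_nat; apply: leq_trans hl' _; rewrite ltnW// ltn_expl.
    move: h1; rewrite ler_pdivrMr//; lra.
  have [y [yO hy]] := hL l'; exists y; split => // c /leE.
    move=> /(_ aP) Ic.
    have [| | | | |_ h] := hy Phi B (dl / 2) c.
    - move=> x Ox; apply: le_trans (modular_sup Ox Ic) _; rewrite lerDl sqrtr_ge0//.
    - exact: modular_measurable aP.
    - exact: ltW.
    - move=> t /andP[t0' tS]; rewrite (admissible_ge0 aP t0')/=.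
      by apply: le_trans (aP.2.1 _ _ t0' tS) _; rewrite lerDl sqr_ge0.
    - by move=> s t hs ht; rewrite le_min => /andP[h _]; exact: u1.
    by apply: le_trans h _; lra.
  move=> /(_ aS) Ic.
  have [| | | | |_ h] := hy (fun t => t ^+ 2) B (dl / 2) c.
  - move=> x Ox; apply: le_trans (_ : Num.sqrt M <= _); last by rewrite lerDr ltW.
    rewrite -ler_sqr ?nnegrE ?modl_ge0 ?sqrtr_ge0// [Num.sqrt M ^+ 2]sqr_sqrtr//.
    apply: le_trans (nik c x Ox) _; rewrite ler_piMr//.
    by apply/leE.
  - exact: modular_measurable aS.
  - exact: ltW.
  - move=> t /andP[t0' tS]; rewrite sqr_ge0/=.
    by apply: le_trans (aS.2.1 _ _ t0' tS) _; rewrite lerDr.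
  - by move=> s t hs ht; rewrite le_min => /andP[_ h]; exact: u2.
  by apply: le_trans h _; lra.
by exists y; split => // c /leE -/(_ aP); exact: yP.
Qed.

End sampling.

(** * Luxemburg norms as gauges *)

Section inf_close.
Context {R : realType}.
Variables (a b : R -> R) (q eps : R).
Hypothesis q1 : 1 <= q.
Hypothesis eps01 : 0 < eps < 1.
Hypothesis a_ge0 : forall l, 0 < l -> 0 <= a l.
Hypothesis a_pow : forall s t, 0 < s -> s <= t -> (s / t) `^ q * a s <= a t.
Hypothesis a_lin : forall s t, 0 < s -> s <= t -> a t <= s / t * a s.
Hypothesis b_lin : forall s t, 0 < s -> s <= t -> b t <= s / t * b s.
Hypothesis ab : forall l, 0 < l -> a l <= 1 -> `|b l - a l| <= eps / 2.

Definition gauge (f : R -> R) : \bar R :=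
  ereal_inf [set l%:E | l in [set l : R | 0 < l /\ f l <= 1]].

Lemma gauge_ge0 f : (0 <= gauge f)%E.
Proof. by apply: le_ereal_inf_tmp => _ [l [l0 _] <-]; rewrite lee_fin ltW. Qed.

Lemma gauge_upper : (gauge b <= (1 + eps)%:E * gauge a)%E.
Proof.
have [e0 e1] := andP eps01.
have e2 : 0 < 1 + eps by lra.
rewrite -lee_pdivrMl//; apply: le_ereal_inf_tmp => _ [l [l0 al] <-].
rewrite lee_pdivrMl// -EFinM; apply: ereal_inf_le.
exists ((1 + eps) * l)%:E => //; exists ((1 + eps) * l) => //.
have l1 : l <= (1 + eps) * l by rewrite ler_peMl ?(ltW l0)//; lra.
split; first by rewrite mulr_gt0.
apply: le_trans (b_lin l0 l1) _.
have -> : l / ((1 + eps) * l) = (1 + eps)^-1 by field; apply/andP; split; rewrite gt_eqF.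
rewrite ler_pdivrMl// mulr1.
have := ab l0 al; rewrite ler_norml => /andP[_]; lra.
Qed.

(** A point t with b t <= 1 is compared with l1 slightly above gauge a:
    there a is at most 1, so b is close to a, and a is close to 1 since a exceeds
    1 slightly below its gauge and decays at most polynomially. *)
Lemma gauge_lower : ((1 - eps)%:E * gauge a <= gauge b)%E.
Proof.
have [e0 e1] := andP eps01.
have finL : gauge a \is a fin_num.
  rewrite ge0_fin_numE ?gauge_ge0//.
  pose l := 1 + a 1.
  have a1 : 0 <= a 1 by apply: a_ge0.
  apply: (@le_lt_trans _ _ l%:E); last exact: ltry.
  apply: ereal_inf_le; exists l%:E => //; exists l => //.
  rewrite /l; split; first by lra.
  have h1 : 1 <= 1 + a 1 by lra.
  apply: le_trans (a_lin ltr01 h1) _.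
  by rewrite div1r ler_pdivrMl; lra.
apply: le_ereal_inf_tmp => _ [t [t0 bt] <-].
pose L := fine (gauge a).
have gL : gauge a = L%:E by rewrite fineK.
have L0 : 0 <= L by rewrite fine_ge0 ?gauge_ge0.
rewrite gL -EFinM lee_fin.
move: (L0); rewrite le_eqVlt => /orP[/eqP <-|Lgt]; first by rewrite mulr0 ltW.
have e2 : 0 < 1 - eps / 2 by lra.
(* l0 < gauge a < l1 are chosen with (l0 / l1)^q = 1 - eps / 2. *)
pose z := (1 - eps / 2) `^ q^-1.
have z0 : 0 < z by rewrite powR_gt0.
have q0 : 0 < q := lt_le_trans ltr01 q1.
have zq : z `^ q = 1 - eps / 2 by rewrite -powRrM mulVf ?gt_eqF// powRr1// ltW.
have z1 : z < 1.
  rewrite ltNge; apply/negP => z1.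
  have : (1 : R) `^ q <= z `^ q.
    by apply: ge0_ler_powR; rewrite ?nnegrE ?(ltW q0) ?(ltW z0).
  by rewrite zq powR1; lra.
pose w := Num.sqrt z.
have w0 : 0 < w by rewrite sqrtr_gt0.
have ww : w * w = z by rewrite -expr2 sqr_sqrtr// ltW.
have w1 : w < 1.
  by rewrite -(@ltr_pXn2r _ 2) ?nnegrE ?(ltW w0)// expr1n expr2 ww.
pose l0 := L * w; pose l1 := L / w.
have l00 : 0 < l0 by rewrite mulr_gt0.
have l10 : 0 < l1 by rewrite divr_gt0.
have l0L : l0 < L by rewrite gtr_pMr.
have Ll1 : L < l1 by rewrite ltr_pdivlMr// gtr_pMr.
have al0 : 1 < a l0.
  rewrite ltNge; apply/negP => al0.
  have : (gauge a <= l0%:E)%E by apply: ereal_inf_le; exists l0%:E => //; exists l0.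
  by rewrite gL lee_fin leNgt l0L.
have al1 : a l1 <= 1.
  have : (gauge a < l1%:E)%E by rewrite gL lte_fin.
  move=> /ereal_inf_lt[_ [s [s0 as1] <-]]; rewrite lte_fin => sl.
  apply: le_trans (a_lin s0 (ltW sl)) _.
  apply: le_trans (_ : s / l1 * 1 <= _).
    by rewrite ler_wpM2l// divr_ge0 ?(ltW s0) ?(ltW l10).
  by rewrite mulr1 ler_pdivrMr// mul1r ltW.
have al1' : 1 - eps / 2 <= a l1.
  apply: le_trans (a_pow l00 (ltW (lt_trans l0L Ll1))).
  have -> : l0 / l1 = z.
    by rewrite /l0 /l1 -ww; field; apply/andP; split; rewrite gt_eqF.
  rewrite zq ler_peMr ?(ltW al0)//; lra.
have bl1 : 1 - eps <= b l1.
  have := ab l10 al1; rewrite ler_norml => /andP[]; lra.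
have [l1t|tl1] := leP l1 t.
  apply: le_trans l1t; apply: le_trans (ltW Ll1).
  by rewrite ler_piMl//; lra.
have h1 := b_lin t0 (ltW tl1).
have h2 : 1 - eps <= t / l1.
  apply: le_trans bl1 _; apply: le_trans h1 _.
  by rewrite ler_piMr// divr_ge0 ?(ltW t0) ?(ltW l10).
move: h2; rewrite ler_pdivlMr// => h2; apply: le_trans h2.
by rewrite ler_wpM2l ?(ltW Ll1)//; lra.
Qed.

End inf_close.

Section empirical.
Context {disp : measure_display} {T : measurableType disp} {R : realType}.

Lemma integral_empirical (m : nat) (x : m.-tuple T) (Omega : set T) (h : T -> R) :
  measurable Omega -> (forall j, Omega (tnth x j)) -> measurable_fun Omega h ->
  (forall z, Omega z -> 0 <= h z) ->
  (\int[empirical_measure x]_(z in Omega) (h z)%:E =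
    ((\sum_(j < m) h (tnth x j)) / m%:R)%:E)%E.
Proof.
move=> mO xO mh h0.
have mE : measurable_fun Omega (EFin \o h) by apply/measurable_EFinP.
rewrite /empirical_measure ge0_integral_mscale//.
rewrite ge0_integral_measure_sum//.
rewrite [X in (_ * X)%E](_ : _ = (\sum_(j < m) h (tnth x j))%:E); last first.
  rewrite -sumEFin; apply: eq_bigr => j _; rewrite -tnth_nth integral_dirac//.
  by rewrite diracE mem_set// mul1e.
by rewrite -EFinM mulrC.
Qed.

End empirical.

(** * Sampling of the Luxemburg norm *)

Section luxemburg_sampling.
Context {R : realType} {T : ptopologicalType}.
Variable Omega : set T.
Notation BT := (g_sigma_algebraType (@open T)).
Hypothesis clO : closed Omega.
Hypothesis coO : compact Omega.
Context {N : nat}.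
Variable U : T -> bool -> 'cV[R]_N.
Hypothesis cU : forall s k, rcont Omega (fun x => U x s k 0).
Variable mu : probability BT R.
Hypothesis muO : mu Omega = 1%E.
Variables (Phi : R -> R) (q r eps : R).
Hypothesis Phi0 : Phi 0 = 0.
Hypothesis Phi_gt0 : forall t : R, 0 < t -> 0 < Phi t.
Hypothesis r12 : 1 <= r <= 2.
Hypothesis q1 : 1 <= q.
Hypothesis Phi_r : pos_increasing (fun t => Phi t * t `^ (- r)).
Hypothesis Phi_q : pos_decreasing (fun t => Phi t * t `^ (- q)).
Hypothesis eps01 : 0 < eps < 1.

Notation modular := (modular Omega U mu).

Let mO : measurable (Omega : set BT).
Proof. exact: closed_borel. Qed.

Let aP : admissible Phi := Phi_admissible Phi0 Phi_gt0 r12 q1 Phi_r Phi_q.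

Lemma Phi_scale_le x t : 0 <= x <= 1 -> 0 <= t -> Phi (x * t) <= x * Phi t.
Proof.
move=> /andP[]; rewrite le_eqVlt => /orP[/eqP <- _ _|x0 x1].
  by rewrite !mul0r Phi0.
rewrite le_eqVlt => /orP[/eqP <-|t0]; first by rewrite mulr0 Phi0 mulr0.
have xt0 : 0 < x * t by rewrite mulr_gt0.
have xtt : x * t <= t by rewrite ger_pMl.
have := Phi_div_pow Phi_r xt0 xtt; rewrite ler_pdivrMr ?powR_gt0// => h.
apply: le_trans h _.
rewrite powRM ?(ltW x0) ?(ltW t0)//.
have -> : Phi t / t `^ r * (x `^ r * t `^ r) = x `^ r * Phi t.
  by field; rewrite gt_eqF ?powR_gt0.
rewrite ler_pM2r ?Phi_gt0//.
have -> : x `^ r = x * x `^ (r - 1).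
  rewrite -{2}(powRr1 (ltW x0)) -powRD; last by rewrite (gt_eqF x0) implybT.
  by congr (_ `^ _); ring.
rewrite ler_piMr ?(ltW x0)//.
have e1 : (1 : R) `^ (r - 1) = 1 by rewrite powR1.
by rewrite -[leRHS]e1; apply: ge0_ler_powR; rewrite ?nnegrE ?subr_ge0 ?(ltW x0)//; case/andP: r12.
Qed.

Lemma modular_leZ k c c' : 0 <= k ->
  (forall x, Omega x -> Phi (modl U c x) <= k * Phi (modl U c' x)) ->
  fine (modular Phi c) <= k * fine (modular Phi c').
Proof.
move=> k0 h; rewrite -lee_fin EFinM !fineK ?(modular_fin clO coO cU muO)//.
have mc' : measurable_fun (Omega : set BT) (fun x : BT => (Phi (modl U c' x))%:E).
  by apply/measurable_EFinP; exact: (modular_measurable clO coO cU c' aP).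
rewrite /modular -ge0_integralZl_EFin//; last first.
  by move=> x Ox; rewrite lee_fin (admissible_ge0 aP)// modl_ge0.
apply: ge0_le_integral => //.
- by move=> x Ox; rewrite lee_fin (admissible_ge0 aP)// modl_ge0.
- by apply/measurable_EFinP; exact: (modular_measurable clO coO cU c aP).
- by apply: emeasurable_funM => //; exact: measurable_cst.
Qed.

Lemma luxemburg_sampling l (y : cube l -> T) :
  (forall p, Omega (y p)) ->
  (forall c, (modular Phi c <= 1)%E ->
     `|avg U Phi y c - fine (modular Phi c)| <= eps / 2) ->
  exists x : (2 ^ l).-tuple BT, (forall j, Omega (tnth x j)) /\
    forall c, ((1 - eps)%:E * luxemburg_norm Phi mu Omega (modl U c) <=
       luxemburg_norm Phi (empirical_measure x) Omega (modl U c) <=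
       (1 + eps)%:E * luxemburg_norm Phi mu Omega (modl U c))%E.
Proof.
move=> yO yc.
pose pt (i : 'I_(2 ^ l)) : cube l := enum_val (cast_ord (esym (card_cube l)) i).
pose x : (2 ^ l).-tuple BT := [tuple (y (pt i) : BT) | i < 2 ^ l].
have xE j : tnth x j = y (pt j) by rewrite tnth_mktuple.
exists x; split; first by move=> j; rewrite xE.
move=> c.
have scale t z : 0 < t -> modl U (t^-1 *: c) z = modl U c z / t.
  by move=> t0; rewrite modlZ ger0_norm ?invr_ge0 ?(ltW t0)// mulrC.
pose a t := fine (modular Phi (t^-1 *: c)).
pose b t := avg U Phi y (t^-1 *: c).
have luxa : luxemburg_norm Phi mu Omega (modl U c) = gauge a.
  congr (ereal_inf (image _ _)); apply/seteqP; split => t /= [t0 ht]; split => //.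
    rewrite /a -lee_fin fineK ?(modular_fin clO coO cU muO)//.
    apply: le_trans ht; rewrite /modular.
    by under eq_integral do rewrite scale//.
  move: ht; rewrite /a -lee_fin fineK ?(modular_fin clO coO cU muO)// /modular.
  by under eq_integral do rewrite scale//.
have luxb : luxemburg_norm Phi (empirical_measure x) Omega (modl U c) = gauge b.
  have bE t : 0 < t ->
      (\int[empirical_measure x]_(z in Omega) (Phi (modl U c z / t))%:E = (b t)%:E)%E.
    move=> t0; rewrite integral_empirical//.
    - congr (_%:E); rewrite /b /avg natrX; congr (_ / _).
      rewrite [RHS](reindex pt); last first.
        apply: onW_bij; exists (fun p => cast_ord (card_cube l) (enum_rank p)) => i.
          by rewrite /pt enum_valK; apply: val_inj.
        by rewrite /pt cast_ordK enum_rankK.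
      by apply: eq_bigr => j _; rewrite xE scale.
    - by move=> j; rewrite xE.
    - have := modular_measurable clO coO cU (t^-1 *: c) aP.
      by congr measurable_fun; apply/funext => z; rewrite scale.
    - by move=> z _; rewrite (admissible_ge0 aP)// divr_ge0 ?modl_ge0// ltW.
  congr (ereal_inf (image _ _)); apply/seteqP; split => t /= [t0 ht]; split => //.
    by move: ht; rewrite bE// lee_fin.
  by rewrite bE// lee_fin.
have ratio (s t : R) : 0 < s -> s <= t -> 0 <= s / t <= 1.
  move=> s0 st; have t0 := lt_le_trans s0 st.
  by rewrite divr_ge0 ?(ltW s0) ?(ltW t0)//= ler_pdivrMr// mul1r.
have rescale (s t : R) z : 0 < s -> s <= t -> modl U (t^-1 *: c) z = s / t * modl U (s^-1 *: c) z.
  move=> s0 st; have t0 := lt_le_trans s0 st; rewrite !scale//.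
  by field; apply/andP; split; rewrite gt_eqF.
have a0 t : 0 < t -> 0 <= a t.
  by move=> t0; rewrite fine_ge0// modular_ge0.
have a_pow s t : 0 < s -> s <= t -> (s / t) `^ q * a s <= a t.
  move=> s0 st; have t0 := lt_le_trans s0 st.
  have k0 : 0 < (s / t) `^ q by rewrite powR_gt0 ?divr_gt0.
  rewrite mulrC -ler_pdivlMr// mulrC; apply: modular_leZ; first by rewrite invr_ge0 ltW.
  move=> z Oz; rewrite mulrC ler_pdivlMr// mulrC (rescale s t)//.
  by apply: (Phi_mul_pow Phi0 q1 Phi_q); [exact: ratio|exact: modl_ge0].
have a_lin s t : 0 < s -> s <= t -> a t <= s / t * a s.
  move=> s0 st; have /andP[k0 k1] := ratio s t s0 st; apply: modular_leZ => // z Oz.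
  by rewrite (rescale s t)//; apply: Phi_scale_le; [exact: ratio|exact: modl_ge0].
have b_lin s t : 0 < s -> s <= t -> b t <= s / t * b s.
  move=> s0 st; rewrite /b /avg mulrA ler_wpM2r ?invr_ge0 ?exprn_ge0//.
  rewrite mulr_sumr; apply: ler_sum => p _; rewrite (rescale s t)//.
  by apply: Phi_scale_le; [exact: ratio|exact: modl_ge0].
have ab t : 0 < t -> a t <= 1 -> `|b t - a t| <= eps / 2.
  move=> t0 h; apply: yc; rewrite -(fineK (modular_fin clO coO cU muO _ aP)) lee_fin//.
rewrite luxa luxb; apply/andP; split.
  exact: (gauge_lower q1 eps01 a0 a_pow a_lin b_lin ab).
exact: (gauge_upper eps01 b_lin ab).
Qed.

End luxemburg_sampling.

(** * Real and complex scalars *)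

Lemma compact_closed_rV (R : realType) d (A : set 'rV[R]_d) : compact A -> closed A.
Proof.
apply: compact_closed; rewrite ball_hausdorff => a b ab.
have [j abj] : exists j, a 0 j != b 0 j.
  apply: contrapT => /forallNP h; move/eqP: ab; apply.
  by apply/rowP => j; apply/eqP/negPn/negP; exact: h.
pose e := `|a 0 j - b 0 j| / 2.
have e0 : 0 < e by rewrite divr_gt0// normr_gt0 subr_eq0.
exists (PosNum e0, PosNum e0); apply/eqP/seteqP; split => // c [/= [_ ac] [_ bc]].
have := ac 0 j; have := bc 0 j; rewrite /ball/= => h1 h2.
have := ler_distD (c 0 j) (a 0 j) (b 0 j); rewrite (distrC (c 0 j)).
by move: h1 h2; rewrite /e; lra.
Qed.

Section scalar_reduction.
Context {R : realType} {T : ptopologicalType}.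
Variable Omega : set T.

Lemma within_rcont (u : T -> R) : {within Omega, continuous u} -> rcont Omega u.
Proof.
move=> /subspace_continuousP cu x Ox e e0.
have /cvgrPdist_lt /(_ e e0) := cu x Ox; rewrite near_withinE.
by apply: filterS => y h /h; rewrite distrC.
Qed.

Lemma within_rcont_complex (u : T -> (R[i] : numFieldType)) : {within Omega, continuous u} ->
  rcont Omega (fun x => complex.Re (u x)) /\ rcont Omega (fun x => complex.Im (u x)).
Proof.
move=> /subspace_continuousP cu.
have key x e : Omega x -> 0 < e -> \forall y \near x, Omega y ->
    ComplexField.Normc.normc (u y - u x) < e.
  move=> Ox e0.
  have e0' : 0 < e%:C%C by rewrite ltcR.
  have /cvgrPdist_lt /(_ _ e0') := cu x Ox; rewrite near_withinE.
  by apply: filterS => y h /h; rewrite distrC normc_def ltcR /=; case: (u y - u x).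
have bound (z : R[i]) : `|complex.Re z| <= ComplexField.Normc.normc z /\
    `|complex.Im z| <= ComplexField.Normc.normc z.
  case: z => a b /=; split; rewrite -ler_sqr ?nnegrE ?sqrtr_ge0// real_normK ?num_real//.
    by rewrite sqr_sqrtr ?addr_ge0 ?sqr_ge0// lerDl sqr_ge0.
  by rewrite sqr_sqrtr ?addr_ge0 ?sqr_ge0// lerDr sqr_ge0.
split => x Ox e e0; have := key x e Ox e0; apply: filterS => y h /h; apply: le_lt_trans.
  by have := (bound (u y - u x)).1; case: (u y) (u x) => [? ?] [? ?].
by have := (bound (u y - u x)).2; case: (u y) (u x) => [? ?] [? ?].
Qed.

(** In the complex case the real coefficients are those of u_k and i u_k. *)
Lemma scalar_reduction (K : numFieldType) (modulus : K -> R) : scalar_field modulus ->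
  forall (N : nat) (X : set (T -> K)), (0 < N)%N -> subspace_of_dim Omega N X ->
  exists (N' : nat) (U : T -> bool -> 'cV[R]_N'),
  [/\ forall s k, rcont Omega (fun x => U x s k 0),
      forall f, X f -> exists c, forall x, Omega x -> modulus (f x) = modl U c x,
      forall c, exists2 f, X f & forall x, Omega x -> modulus (f x) = modl U c x &
      exists c x, Omega x /\ modl U c x != 0].
Proof.
move=> sf N X N0 [u [cu li ->]].
have nz : exists x, Omega x /\ u (Ordinal N0) x != 0.
  apply: contrapT => /forallNP h.
  have : ((Ordinal N0 == Ordinal N0)%:R : K) = 0.
    apply: (li (fun i => (i == Ordinal N0)%:R)) => x Ox.
    rewrite (bigD1 (Ordinal N0))//= ?eqxx mul1r big1 ?addr0; last first.
      by move=> i /negbTE ->; rewrite mul0r.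
    by apply/eqP/negPn/negP => ux; apply: (h x).
  by rewrite eqxx => /eqP; rewrite oner_eq0.
have [xnz [Oxnz unz]] := nz.
have Xu0 : exists c : 'I_N -> K, forall x, Omega x -> u (Ordinal N0) x = \sum_(i < N) c i * u i x.
  exists (fun i => (i == Ordinal N0)%:R) => x Ox.
  rewrite (bigD1 (Ordinal N0))//= ?eqxx mul1r big1 ?addr0//.
  by move=> i /negbTE ->; rewrite mul0r.
suff [N' [U [h1 h2 h3 h4]]] : exists (N' : nat) (U : T -> bool -> 'cV[R]_N'),
  [/\ forall s k, rcont Omega (fun x => U x s k 0),
      forall c, exists c', forall x, Omega x -> modulus (\sum_(i < N) c i * u i x) = modl U c' x,
      forall c, exists c', forall x, Omega x -> modulus (\sum_(i < N) c' i * u i x) = modl U c x &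
      forall z, modulus z = 0 -> z = 0].
  have h2' f : [set f | exists c : 'I_N -> K,
       forall x, Omega x -> f x = \sum_(i < N) c i * u i x] f ->
      exists c, forall x, Omega x -> modulus (f x) = modl U c x.
    move=> [c fc]; have [c' hc'] := h2 c; exists c' => x Ox; rewrite fc//; exact: hc'.
  exists N', U; split => //.
    move=> c; have [c' hc'] := h3 c; exists (fun x => \sum_(i < N) c' i * u i x) => //=.
    by exists c'.
  have [c hc] := h2' _ Xu0; exists c, xnz; split => //.
  by rewrite -hc//; apply: contra_neq unz; exact: h4.
clear li nz xnz Oxnz unz Xu0 X; case: sf u cu => [u cu|u cu].
- exists N, (fun x s => if s then 0 else \col_k u k x).
  have E (c : 'rV_N) x : modl (fun x s => if s then 0 else \col_k u k x) c x =
      `|\sum_(i < N) c 0 i * u i x|.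
    rewrite /modl /hypot /cval mulmx0 [X in X ^+ 2 + _]mxE [X in _ + X ^+ 2]mxE expr0n/= addr0 sqrtr_sqr.
    by congr `|_|; apply: eq_bigr => i _; rewrite mxE.
  split.
  + move=> [] k.
      by move=> x Ox e e0; near=> y => _; rewrite !mxE subrr normr0.
    move=> x Ox e e0; have := within_rcont (cu k) Ox e0.
    by apply: filterS => y h Oy; rewrite !mxE; exact: h.
  + move=> c; exists (\row_i c i) => x Ox; rewrite E; congr `|_|.
    by apply: eq_bigr => i _; rewrite mxE.
  + by move=> c; exists (fun i => c 0 i) => x Ox; rewrite E.
  + by move=> z /normr0_eq0.
- pose U x (s : bool) : 'cV[R]_(N + N) :=
    if s then col_mx (\col_k complex.Im (u k x)) (\col_k complex.Re (u k x))
    else col_mx (\col_k complex.Re (u k x)) (\col_k - complex.Im (u k x)).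
  have E (a b : 'I_N -> R) x : modl U (row_mx (\row_i a i) (\row_i b i)) x =
      ComplexField.Normc.normc (\sum_(i < N) (a i +i* b i)%C * u i x).
    have ReE : complex.Re (\sum_(i < N) (a i +i* b i)%C * u i x) =
        \sum_(i < N) (a i * complex.Re (u i x) - b i * complex.Im (u i x)).
      rewrite (raddf_sum (@complex.Re R)); apply: eq_bigr => i _.
      by case: (u i x).
    have ImE : complex.Im (\sum_(i < N) (a i +i* b i)%C * u i x) =
        \sum_(i < N) (a i * complex.Im (u i x) + b i * complex.Re (u i x)).
      rewrite (raddf_sum (@complex.Im R)); apply: eq_bigr => i _.
      by case: (u i x).
    rewrite /modl /hypot /cval /U /= !mul_row_col.
    move: ReE ImE; case: (\sum_(i < N) (a i +i* b i)%C * u i x) => re im /= -> ->.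
    congr Num.sqrt; congr (_ ^+ 2 + _ ^+ 2).
      rewrite !mxE -big_split/=; apply: eq_bigr => i _.
      by rewrite !mxE mulrN.
    by rewrite !mxE -big_split/=; apply: eq_bigr => i _; rewrite !mxE.
  exists (N + N)%N, U; split.
  + move=> s k x Ox e e0; rewrite /U.
    case: (split_ordP k) => j ->; have [cR cI] := within_rcont_complex (cu j).
      case: s; rewrite ?col_mxEu.
        by have := cI x Ox e e0; apply: filterS => y h Oy; rewrite !col_mxEu !mxE; exact: h.
      by have := cR x Ox e e0; apply: filterS => y h Oy; rewrite !col_mxEu !mxE; exact: h.
    case: s.
      by have := cR x Ox e e0; apply: filterS => y h Oy; rewrite !col_mxEd !mxE; exact: h.
    have := cI x Ox e e0; apply: filterS => y h Oy; rewrite !col_mxEd !mxE -opprD normrN.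
    exact: h.
  + move=> c; exists (row_mx (\row_i complex.Re (c i)) (\row_i complex.Im (c i))) => x Ox; rewrite E.
    by congr ComplexField.Normc.normc; apply: eq_bigr => i _; case: (c i).
  + move=> c; exists (fun i => (c 0 (lshift N i) +i* c 0 (rshift N i))%C) => x Ox.
    rewrite -E; congr (modl U _ x); apply/rowP => k.
    by case: (split_ordP k) => j ->; rewrite ?row_mxEl ?row_mxEr !mxE.
  + by move=> z; exact: ComplexField.Normc.eq0_normc.
Unshelve. all: by end_near. Qed.

End scalar_reduction.

(** * Choice of the number of points *)

Section constants.
Context {R : realType}.

Lemma ln2_ge : 2^-1 <= ln (2 : R).
Proof.
rewrite -ler_expR lnK ?posrE//.
have h := expR_ge1Dx (- 2^-1 : R).
rewrite -[leRHS]invrK -[expR _]invrK -expRN lef_pV2 ?posrE ?invr_gt0 ?expR_gt0//; lra.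
Qed.

Lemma log2_double_ge1 (M : R) : 1 <= M -> 1 <= log2 (2 * M).
Proof.
move=> M1; have l2 : 0 < ln (2 : R) by have := ln2_ge; lra.
by rewrite /log2 ler_pdivlMr// mul1r ler_ln ?posrE//; lra.
Qed.

(** With i large, C = 2 * 16^i makes l of order i * log2 (2 M), and l^3 costs only
    i^3 while C provides i^4. *)
Lemma choose_level (K q phi : R) : 0 <= K -> 1 <= q -> 0 < phi ->
  exists2 C : R, 0 < C & forall G M : R, 1 <= M -> phi <= G -> G <= phi * M `^ q ->
  exists l : nat, [/\ (8 <= l)%N, K * G * l%:R ^+ 3 <= 2 ^+ l &
    2 ^+ l <= C * G * log2 (2 * M) ^+ 3].
Proof.
move=> K0 q1 phi0.
have l2 := ln2_ge; have l20 : 0 < ln (2 : R) by lra.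
pose E := 7 + q + 2 * `|ln phi|.
have E0 : 0 <= E by rewrite addr_ge0 ?mulr_ge0//; lra.
have iphi : 0 < 256 / phi by rewrite divr_gt0.
(* The three summands give l <= 5 i log2 (2 M), pay for K, and ensure l >= 8. *)
pose i := (Num.trunc (E + 125 * K + 256 / phi + 1)).+1.
have iP : E + 125 * K + 256 / phi + 1 < i%:R by exact: truncnS_gt.
clearbody i.
have i1 : 1 <= i%:R :> R by lra.
have i0 : 0 < i%:R :> R by lra.
pose C1 : R := (2 ^+ i) ^+ 4.
have C1i : i%:R ^+ 4 <= C1.
  by rewrite /C1 lerXn2r ?nnegrE ?exprn_ge0// -natrX ler_nat ltnW// ltn_expl.
have C10 : 0 < C1 by rewrite !exprn_gt0.
exists (2 * C1); first by rewrite mulr_gt0.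
move=> G M M1 G0 G1.
have M0 : 0 < M by lra.
have Gpos : 0 < G by lra.
have L1 := log2_double_ge1 M1.
set Lam := log2 (2 * M) in L1 *.
have Lam0 : 0 < Lam by lra.
have lnLam : Lam * ln 2 = ln 2 + ln M.
  by rewrite /Lam /log2 divfK ?gt_eqF// lnM ?posrE.
pose X := C1 * G * Lam ^+ 3.
have L31 : 1 <= Lam ^+ 3 by rewrite exprn_ege1.
have C1ge : i%:R <= C1.
  by apply: le_trans C1i; rewrite -[leLHS]expr1 ler_weXn2l.
have X8 : 2 ^+ 8 <= X.
  apply: le_trans (_ : C1 * G * 1 <= _); last by rewrite /X ler_wpM2l// mulr_ge0// ltW.
  rewrite mulr1; apply: le_trans (_ : 256 / phi * phi <= _).
    by rewrite divfK ?gt_eqF// -natrX.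
  by apply: ler_pM => //; [exact: ltW|exact: ltW|apply: le_trans C1ge; lra].
have X0 : 0 < X by apply: lt_le_trans X8; rewrite exprn_gt0.
have exl : exists n, X <= 2 ^+ n.
  exists (Num.trunc X).+1; apply: le_trans (ltW (truncnS_gt X)) _.
  by rewrite -natrX ler_nat ltnW// ltn_expl.
have [l Xl minl] := ex_minnP exl.
have l8 : (8 <= l)%N.
  have : (2 : R) ^+ 8 <= 2 ^+ l := le_trans X8 Xl.
  by rewrite ler_eXn2l// ltr1n.
have l0 : (0 < l)%N by apply: leq_trans l8.
have Xl1 : 2 ^+ l.-1 < X.
  rewrite ltNge; apply/negP => /minl; rewrite leqNgt; move/negP; apply.
  by rewrite prednK.
have lB : l%:R <= 5 * i%:R * Lam.
  have h1 : l.-1%:R * ln 2 <= ln X.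
    have : ln (2 ^+ l.-1) <= ln X by rewrite ler_ln ?posrE ?exprn_gt0// ltW.
    by rewrite lnXn// mulr_natl.
  have h2 : ln X = 4 * (i%:R * ln 2) + ln G + 3 * ln Lam.
    have CG0 : 0 < C1 * G by rewrite mulr_gt0.
    have L30 : 0 < Lam ^+ 3 by rewrite exprn_gt0.
    have -> : ln X = ln C1 + ln G + ln (Lam ^+ 3).
      by rewrite /X (lnM (x := C1 * G)) ?posrE// (lnM (x := C1)) ?posrE.
    have -> : ln C1 = 4 * (i%:R * ln 2).
      by rewrite /C1 lnXn ?exprn_gt0// lnXn// -[_ *+ 4]mulr_natl -[_ *+ i]mulr_natl.
    by rewrite lnXn// -[_ *+ 3]mulr_natl.
  have h3 : ln G <= ln phi + q * ln M.
    rewrite -ln_powR -lnM ?posrE ?powR_gt0//.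
    by rewrite ler_ln ?posrE ?mulr_gt0 ?powR_gt0.
  have h4 : ln Lam <= Lam := ltW (ln_sublinear Lam0).
  have h5 := ler_norm (ln phi).
  have h6 : l%:R = l.-1%:R + 1 :> R by rewrite natr1 prednK.
  have lM0 : 0 <= ln M by rewrite ln_ge0.
  have h7 : q * ln M <= q * (Lam * ln 2) by rewrite ler_wpM2l//; lra.
  have h8 : l.-1%:R * ln 2 <= (4 * i%:R + 2 * `|ln phi| + q * Lam + 6 * Lam) * ln 2.
    have : Lam <= 2 * Lam * ln 2 by rewrite -mulrA mulrCA -[leLHS]mulr1 ler_wpM2l ?(ltW Lam0)//; lra.
    have : `|ln phi| <= 2 * `|ln phi| * ln 2 by rewrite -mulrA mulrCA -[leLHS]mulr1 ler_wpM2l//; lra.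
    lra.
  rewrite ler_pM2r// in h8.
  apply: le_trans (_ : (4 * i%:R + E) * Lam <= _).
    have : 0 <= (4 * i%:R + 2 * `|ln phi| + 1) * (Lam - 1).
      by rewrite mulr_ge0// ?subr_ge0// addr_ge0// addr_ge0// mulr_ge0//.
    by rewrite h6 /E; lra.
  by rewrite ler_wpM2r ?(ltW Lam0)//; lra.
exists l; split => //.
  apply: le_trans Xl; apply: le_trans (_ : K * G * (5 * i%:R * Lam) ^+ 3 <= _).
    rewrite ler_wpM2l ?mulr_ge0 ?(ltW Gpos)// lerXn2r ?nnegrE//.
    by apply: mulr_ge0; [apply: mulr_ge0|]; rewrite // ltW.
  have -> : K * G * (5 * i%:R * Lam) ^+ 3 = (125 * K * i%:R ^+ 3) * (G * Lam ^+ 3) by ring.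
  have -> : X = C1 * (G * Lam ^+ 3) by rewrite /X mulrA.
  apply: ler_wpM2r.
    by apply: mulr_ge0; [exact: ltW|apply: exprn_ge0; exact: ltW].
  apply: le_trans C1i; rewrite [leRHS]exprS; apply: ler_wpM2r; last by lra.
  by apply: exprn_ge0; exact: ltW.
have -> : 2 * C1 * G * Lam ^+ 3 = 2 * X by rewrite /X !mulrA.
have -> : 2 ^+ l = 2 * 2 ^+ l.-1 :> R by rewrite -exprS prednK.
by apply: ler_wpM2l => //; exact: ltW.
Qed.

End constants.

Section Phi_function_facts.
Context {R : realType}.
Variable Phi : R -> R.
Hypothesis PhiP : Phi_function Phi.

Lemma Phi_function_gt0 q t : pos_decreasing (fun t => Phi t * t `^ (- q)) ->
  0 < t -> 0 < Phi t.
Proof.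
move=> Pq t0; have /cvgryPge /(_ 1) [t1 [_ ht1]] := Phi_cvgy PhiP.
pose s := t + `|t1| + 1.
have s1 : 1 <= Phi s by apply: ht1; have := ler_norm t1; rewrite /s; lra.
have ts : t <= s by rewrite /s; have := normr_ge0 t1; lra.
have s0 : 0 < s := lt_le_trans t0 ts.
have h := Pq t s t0 ts.
have h0 : 0 < Phi t * t `^ (- q).
  by apply: lt_le_trans h; rewrite mulr_gt0 ?powR_gt0//; lra.
by move: h0; rewrite pmulr_lgt0// powR_gt0.
Qed.

Lemma pos_increasing_exponent p r : r <= p ->
  pos_increasing (fun t => Phi t * t `^ (- p)) ->
  pos_increasing (fun t => Phi t * t `^ (- r)).
Proof.
move=> rp Pp s t s0 st; have t0 := lt_le_trans s0 st.
have split x : 0 < x -> Phi x * x `^ (- r) = Phi x * x `^ (- p) * x `^ (p - r).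
  move=> x0; rewrite -mulrA -powRD; last by rewrite (gt_eqF x0) implybT.
  by congr (_ * _ `^ _); ring.
rewrite !split//; apply: ler_pM; rewrite ?powR_ge0//.
- by rewrite mulr_ge0 ?powR_ge0// Phi_ge0// ltW.
- exact: Pp.
- by apply: ge0_ler_powR; rewrite ?nnegrE ?subr_ge0 ?(ltW s0) ?(ltW t0).
Qed.

End Phi_function_facts.

(** * The Nikolskii condition and the conclusion *)

Section nikolskii.
Context {R : realType} {T : ptopologicalType}.
Variable Omega : set T.
Notation BT := (g_sigma_algebraType (@open T)).
Hypothesis clO : closed Omega.
Hypothesis coO : compact Omega.
Context {N : nat}.
Variable U : T -> bool -> 'cV[R]_N.
Hypothesis cU : forall s k, rcont Omega (fun x => U x s k 0).
Variable mu : probability BT R.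
Hypothesis muO : mu Omega = 1%E.
Variable M : R.
Hypothesis M0 : 0 <= M.

Notation modular := (modular Omega U mu).
Notation sq := (fun t : R => t ^+ 2).

Lemma nikolskii_sqr (g : BT -> R) c : (forall x, Omega x -> g x = modl U c x) ->
  (sup_norm Omega g <= (Num.sqrt M)%:E * L2_norm mu Omega g)%E ->
  forall x, Omega x -> ((modl U c x ^+ 2)%:E <= M%:E * modular sq c)%E.
Proof.
move=> gc h x Ox.
have fin : modular sq c \is a fin_num by exact: (modular_fin clO coO cU muO c sqr_admissible).
have I0 : 0 <= fine (modular sq c) by rewrite fine_ge0// modular_ge0//; exact: sqr_admissible.
have L2 : L2_norm mu Omega g = (Num.sqrt (fine (modular sq c)))%:E.
  rewrite /L2_norm -powR12_sqrt// -poweR_EFin fineK//; congr poweR.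
  by apply: eq_integral => z /set_mem Oz; rewrite gc.
have gx : ((g x)%:E <= sup_norm Omega g)%E by apply: ereal_sup_ubound; exists x.
have := le_trans gx h; rewrite L2 -EFinM lee_fin gc// => hx.
rewrite -(fineK fin) -EFinM lee_fin.
rewrite -[M]sqr_sqrtr// -[X in _ * X]sqr_sqrtr// -exprMn.
by rewrite ler_sqr ?nnegrE ?modl_ge0// mulr_ge0 ?sqrtr_ge0.
Qed.

(** Integrating the pointwise inequality against mu gives I <= M I for the
    integral I of |f|^2. *)
Lemma nikolskii_ge1 c x :
  (forall x, Omega x -> ((modl U c x ^+ 2)%:E <= M%:E * modular sq c)%E) ->
  Omega x -> modl U c x != 0 -> 1 <= M.
Proof.
move=> h Ox cx.
have mO : measurable (Omega : set BT) by exact: closed_borel.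
have fin : modular sq c \is a fin_num by exact: (modular_fin clO coO cU muO c sqr_admissible).
have hx z : Omega z -> modl U c z ^+ 2 <= M * fine (modular sq c).
  move=> Oz; rewrite -lee_fin; apply: le_trans (h z Oz) _.
  by rewrite (EFinM M) fineK.
have I0 : 0 < fine (modular sq c).
  rewrite lt_neqAle fine_ge0 ?andbT; last by rewrite modular_ge0//; exact: sqr_admissible.
  apply: contra_neq cx => I0; have := hx x Ox; rewrite -I0 mulr0 => h0.
  by apply/eqP; rewrite -sqrf_eq0 eq_le h0 sqr_ge0.
have : (modular sq c <= (M * fine (modular sq c))%:E)%E.
  apply: le_trans (_ : \int[mu]_(z in Omega) (cst (M * fine (modular sq c))%:E z) <= _)%E.
    apply: ge0_le_integral => //.
    - by move=> z _; rewrite lee_fin sqr_ge0.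
    - by apply/measurable_EFinP; exact: (modular_measurable clO coO cU c sqr_admissible).
  by rewrite integral_cst// [X in (_ * X)%E](_ : _ = 1%E) ?mule1.
by rewrite -{1}(fineK fin) lee_fin -{1}[fine _]mul1r ler_pM2r.
Qed.

End nikolskii.

Lemma eq_luxemburg (disp : measure_display) (T : measurableType disp) (R : realType)
    (Phi : R -> R) (nu : {measure set T -> \bar R}) (Omega : set T) (g h : T -> R) :
  (forall x, Omega x -> g x = h x) ->
  luxemburg_norm Phi nu Omega g = luxemburg_norm Phi nu Omega h.
Proof.
move=> gh; congr (ereal_inf (image _ _)); apply/seteqP; split => t /= [t0 ht]; split => //.
  by rewrite (_ : integral _ _ _ = \int[nu]_(x in Omega) (Phi (g x / t))%:E)%E//;
     apply: eq_integral => x /set_mem Ox; rewrite gh.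
by rewrite (_ : integral _ _ _ = \int[nu]_(x in Omega) (Phi (h x / t))%:E)%E//;
   apply: eq_integral => x /set_mem Ox; rewrite gh.
Qed.

Section radius.
Context {R : realType}.
Variables (Phi : R -> R) (q r M : R).
Hypothesis Phi0 : Phi 0 = 0.
Hypothesis Phi_gt0 : forall t : R, 0 < t -> 0 < Phi t.
Hypothesis r12 : 1 <= r <= 2.
Hypothesis q1 : 1 <= q.
Hypothesis Phi_r : pos_increasing (fun t => Phi t * t `^ (- r)).
Hypothesis Phi_q : pos_decreasing (fun t => Phi t * t `^ (- q)).
Hypothesis M1 : 1 <= M.

Lemma Phi_dilate k t : 1 <= k -> 0 <= t -> Phi (k * t) <= k `^ q * Phi t.
Proof.
move=> k1 t0; have k0 : 0 < k := lt_le_trans ltr01 k1.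
have := @Phi_mul_pow R Phi q Phi0 q1 Phi_q k^-1 (k * t).
rewrite mulrA mulVf ?gt_eqF// mul1r => /(_ _ _)/wrap[].
- by rewrite invr_ge0 (ltW k0) invf_le1.
- by rewrite mulr_ge0// ltW.
move=> h; rewrite -ler_pdivrMl ?powR_gt0//; apply: le_trans h.
by rewrite -[k^-1]powR_inv1 ?(ltW k0)// -powRrM mulN1r powRN.
Qed.

Let root1 : 1 <= M `^ r^-1.
Proof.
have e1 : (1 : R) `^ r^-1 = 1 by rewrite powR1.
rewrite -[leLHS]e1; apply: ge0_ler_powR; rewrite ?nnegrE ?(le_trans ler01 M1)//.
by rewrite invr_ge0; case/andP: r12; lra.
Qed.

Lemma Phi_root_ge : Phi 1 <= Phi (M `^ r^-1).
Proof. exact: (Phi_mono Phi0 Phi_gt0 r12 Phi_r). Qed.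

Let root_le (k : R) : 1 <= k -> k `^ r^-1 <= k.
Proof. by move=> k1; apply: ler1_powR => //; rewrite invf_le1; case/andP: r12; lra. Qed.

Lemma Phi_root_le : Phi (M `^ r^-1) <= Phi 1 * M `^ q.
Proof.
have := Phi_dilate root1 ler01; rewrite mulr1 => h; apply: le_trans h _.
rewrite mulrC ler_pM2l ?Phi_gt0//.
apply: ge0_ler_powR; rewrite ?nnegrE ?powR_ge0 ?(le_trans ler01)//; exact: root_le.
Qed.

Lemma Phi_sup_radius_le :
  Phi (sup_radius Phi r M) <= (2 * (kap Phi + 1)) `^ q * Phi (M `^ r^-1).
Proof.
have k1 : 1 <= 2 * (kap Phi + 1).
  have : 0 < (Phi 1)^-1 by rewrite invr_gt0 Phi_gt0.
  by rewrite /kap; lra.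
have t0 : 0 <= M `^ r^-1 by exact: powR_ge0.
apply: le_trans (Phi_dilate k1 t0).
apply: (Phi_mono Phi0 Phi_gt0 r12 Phi_r); first exact: powR_ge0.
rewrite /sup_radius powRM ?(le_trans ler01)//.
by rewrite ler_wpM2r// root_le.
Qed.

End radius.

Theorem theorem1p1 (R : realType) (Phi : R -> R) (eps : R) :
  Phi_function Phi -> 0 < eps < 1 ->
  exists2 C : R, 0 < C &
  forall p : R, 1 <= p ->
  pos_increasing (fun t => Phi t * t `^ (- p)) ->
  (exists2 q : R, p <= q & pos_decreasing (fun t => Phi t * t `^ (- q))) ->
  forall (K : numFieldType) (modulus : K -> R), scalar_field modulus ->
  forall (d : nat) (Omega : set 'rV[R]_d), compact Omega ->
  forall mu : probability (borel_rV R d) R, mu Omega = 1%E ->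
  forall (N : nat) (B : R), (1 <= N)%N -> 0 < B ->
  forall X : set ('rV[R]_d -> K), subspace_of_dim Omega N X ->
  (forall f, X f ->
    (sup_norm Omega (modulus \o f) <=
     (Num.sqrt (B * N%:R))%:E * L2_norm mu Omega (modulus \o f))%E) ->
  exists (m : nat) (x : m.-tuple (borel_rV R d)),
    [/\ (0 < m)%N,
        m%:R <= C * Phi ((B * N%:R) `^ (Num.min p 2)^-1) *
                log2 (2 * (B * N%:R)) ^+ 3,
        forall j : 'I_m, Omega (tnth x j)
      & forall f, X f ->
          ((1 - eps)%:E * luxemburg_norm Phi mu Omega (modulus \o f) <=
           luxemburg_norm Phi (empirical_measure x) Omega (modulus \o f) <=
           (1 + eps)%:E * luxemburg_norm Phi mu Omega (modulus \o f))%E].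
Proof.
move=> PhiP eps01; have [e0 e1] := andP eps01.
have [[q [q1 Pq]]|no] := pselect (exists q : R, 1 <= q /\
    pos_decreasing (fun t => Phi t * t `^ (- q))); last first.
  (* If no exponent q exists, there is nothing to prove and C is irrelevant. *)
  exists 1 => // p p1 _ [q pq Pq]; exfalso; apply: no.
  by exists q; split => //; exact: le_trans pq.
have Pgt0 (t : R) : 0 < t -> 0 < Phi t := Phi_function_gt0 PhiP Pq.
have P0 := Phi0 PhiP.
have P1 : 0 < Phi 1 by exact: Pgt0.
have Th0 : 0 <= Theta Phi q := Theta_ge0 q Pgt0.
have Th1 : 0 <= 1600 * Theta Phi q by apply: mulr_ge0 Th0; exact: ler0n.
pose k2 := 2 * (kap Phi + 1).
pose K0 := 1600 * Theta Phi q * k2 `^ q / (eps / 2) ^+ 2.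
have K00 : 0 <= K0.
  apply: divr_ge0; last exact: sqr_ge0.
  by apply: mulr_ge0; [exact: Th1|exact: powR_ge0].
have [C C0 levels] := choose_level K00 q1 P1.
exists C => // p p1 Pp _ K modulus sf d Omega coO mu muO N B N1 B0 X dimX nikX.
pose r := Num.min p 2.
have r12 : 1 <= r <= 2.
  by rewrite /r ge_min lexx orbT andbT le_min p1 /=; lra.
have Pr : pos_increasing (fun t => Phi t * t `^ (- r)).
  by apply: (pos_increasing_exponent PhiP _ Pp); rewrite /r ge_min lexx.
have clO := compact_closed_rV coO.
set M := B * N%:R in nikX *.
have M0 : 0 <= M by rewrite mulr_ge0// ltW.
have [N' [U [cU XU UX [c0 [x0 [Ox0 nz]]]]]] := scalar_reduction sf N1 dimX.
have nik c x : Omega x ->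
    ((modl U c x ^+ 2)%:E <= M%:E * modular Omega U mu (fun t => t ^+ 2)%R c)%E.
  have [f Xf fc] := UX c.
  by apply: (nikolskii_sqr clO coO cU muO M0 _ (nikX f Xf)) => z Oz; exact: fc.
have M1 : 1 <= M := nikolskii_ge1 clO coO cU muO (nik c0) Ox0 nz.
have G1 := Phi_root_ge P0 Pgt0 r12 Pr M1.
have G2 := Phi_root_le P0 Pgt0 r12 q1 Pq M1.
have [l [l8 Kl lC]] := levels _ M M1 G1 G2.
have eps2 : 0 < eps / 2 <= 2^-1 by apply/andP; split; lra.
have [y [yO yP]] : exists y : cube l -> 'rV[R]_d, (forall p, Omega (y p)) /\
    forall c, (modular Omega U mu Phi c <= 1)%E ->
      `|avg U Phi y c - fine (modular Omega U mu Phi c)| <= eps / 2.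
  apply: (modular_sampling clO coO cU muO P0 Pgt0 r12 q1 Pr Pq M1 nik l8 eps2).
  have e20 : 0 < (eps / 2) ^+ 2 by rewrite exprn_gt0// divr_gt0.
  apply: le_trans (_ : (eps / 2) ^+ 2 * (K0 * Phi (M `^ r^-1) * l%:R ^+ 3) <= _); last first.
    by rewrite ler_pM2l.
  have -> : (eps / 2) ^+ 2 * (K0 * Phi (M `^ r^-1) * l%:R ^+ 3) =
      1600 * Theta Phi q * (k2 `^ q * Phi (M `^ r^-1)) * l%:R ^+ 3.
    by rewrite /K0; field; rewrite gt_eqF.
  apply: ler_wpM2r; first exact: exprn_ge0.
  apply: ler_wpM2l; first exact: Th1.
  exact: (Phi_sup_radius_le P0 Pgt0 r12 q1 Pr Pq M1).
have [x [xO xP]] := luxemburg_sampling clO coO cU muO P0 Pgt0 r12 q1 Pr Pq eps01 yO yP.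
exists (2 ^ l)%N, x; split => //.
- by rewrite expn_gt0.
- by rewrite natrX.
- move=> f Xf; have [c fc] := XU f Xf.
  have gE z : Omega z -> (modulus \o f) z = modl U c z by move=> Oz; exact: fc.
  rewrite (eq_luxemburg Phi mu gE) (eq_luxemburg Phi (empirical_measure x) gE).
  exact: xP.
Qed.
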